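(* Let $\Gamma$ be a $\mathbb Z^d$-periodic graph, $d\ge 2$, and let $H=\Delta+Q$ be the Schrödinger operator on $\ell^2(V)$ with a real $\mathbb Z^d$-periodic potential $Q$ (notation as in the context). Then: (i) The smallest eigenvalue $\lambda_1(0)$ of the fiber operator $H(0)$ is simple and has an eigenvector $\psi\in\ell^2(V_* )$ all of whose components are positive. (ii) The first spectral band $\sigma_1(H)=[\lambda_1^-,\lambda_1^+]$ of $H$ is nondegenerate, i.e. $\lambda_1^-<\lambda_1^+$, and $$c_0^{-2}\,|\sigma_1(\Delta)|\le |\sigma_1(H)|\le c_0^{2}\,|\sigma_1(\Delta)|,\qquad c_0=\frac{\psi_+}{\psi_-},\quad \psi_-=\min_{v\in V_*}\frac{\psi(v)}{\sqrt{\varkappa_v}},\quad \psi_+=\max_{v\in V_*}\frac{\psi(v)}{\sqrt{\varkappa_v}},$$ where $\sigma_1(\Delta)$ is the first spectral band of the Laplacian $\Delta$ and $|\cdot|$ denotes length. (iii) The effective mass tensor $m$ of $H$ at the bottom of the spectrum satisfies (in the sense of quadratic forms on $\mathbb R^d$) $$c_0^{-2}\,m_0\le m\le c_0^{2}\,m_0,$$ where $m_0$ is the effective mass tensor of the Laplacian $\Delta$ at the bottom of its spectrum. Here, writing $\lambda_1(\vartheta)=\lambda_1(0)+\frac12\sum_{i,j=1}^d M_{ij}\vartheta_i\vartheta_j+O(|\vartheta|^3)$ with $M_{ij}=\frac{\partial^2\lambda_1(0)}{\partial\vartheta_i\partial\vartheta_j}$, the effective mass tensor is $m=M^{-1}$,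 $M=\{M_{ij}\}$; $m_0$ is defined in the same way from the first band function $\lambda^0_1(\vartheta)$ of $\Delta(\vartheta)$.
   Context: Setting. $\Gamma=(V,\mathcal E)$ is a connected infinite graph, possibly with loops and multiple edges, on which $\mathbb Z^d$ ($d\ge2$) acts freely by graph automorphisms (the action of $m\in\mathbb Z^d$ on $v\in V$ is written $v+m$), every vertex has finite degree, and the quotient (fundamental) graph $\Gamma_*=\Gamma/\mathbb Z^d=(V_*,\mathcal E_* )$ is finite; $\nu=\#V_*$. Each undirected edge is regarded as two oppositely oriented edges; $\mathcal A$ denotes the set of oriented edges of $\Gamma$ (an edge $\mathbf e=(u,v)$ goes from $u$ to $v$), and $\mathcal A_*=\mathcal A/\mathbb Z^d$. The degree $\varkappa_v$ of a vertex $v$ is the number of oriented edges starting at $v$ (it is $\mathbb Z^d$-invariant, hence defined for $v\in V_*$). The normalized Laplacian on $\ell^2(V)$ is $(\Delta f)(v)=f(v)-\sum_{(v,u)\in\mathcal A}\frac{1}{\sqrt{\varkappa_v\varkappa_u}}f(u)$, and $H=\Delta+Q$, where $Q:V\to\mathbb R$ satisfies $Q(v+m)=Q(v)$ (so $Q$ is also a function on $V_*$). Edge indices. Fix a subtree $T$ of $\Gamma$ whose vertex set $V_0$ consists of $\nu$ pairwise non-$\mathbb Z^d$-equivalent vertices (such trees exist). Every $v\in V$ is uniquely $v=v_0+[v]$ with $v_0\in V_0$, $[v]\in\mathbb Z^d$. The index of $\mathbf e=(u,v)\in\mathcal A$ is $\tau(\mathbf e)=[v]-[u]\in\mathbb Z^d$;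 it is invariant under the $\mathbb Z^d$-action, so it defines $\tau$ on $\mathcal A_*$. Fiber operators and bands. For $\vartheta\in\mathbb T^d=\mathbb R^d/(2\pi\mathbb Z)^d$, the operators on $\ell^2(V_* )\cong\mathbb C^\nu$ are $(\Delta(\vartheta)f)(v)=f(v)-\sum_{\mathbf e=(v,u)\in\mathcal A_*}\frac{e^{i\langle\tau(\mathbf e),\vartheta\rangle}}{\sqrt{\varkappa_v\varkappa_u}}f(u)$ and $H(\vartheta)=\Delta(\vartheta)+Q$; $H$ is unitarily equivalent to $\frac{1}{(2\pi)^d}\int^{\oplus}_{\mathbb T^d}H(\vartheta)\,d\vartheta$. Let $\lambda_1(\vartheta)\le\dots\le\lambda_\nu(\vartheta)$ be the eigenvalues of $H(\vartheta)$ (with multiplicity) and $\sigma_n(H)=[\lambda_n^-,\lambda_n^+]=\lambda_n(\mathbb T^d)$ the spectral bands, so $\sigma(H)=\bigcup_{n=1}^\nu\sigma_n(H)$. Analogously $\lambda^0_n(\vartheta)$ are the eigenvalues of $\Delta(\vartheta)$ and $\sigma_n(\Delta)=[\lambda_n^{0-},\lambda_n^{0+}]=\lambda^0_n(\mathbb T^d)$. A band is nondegenerate if it is not a single point. *)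

(* Defs.v *)
From mathcomp Require Import all_boot all_order all_algebra.
From mathcomp Require Import complex.
From mathcomp Require Import all_classical all_reals all_analysis.
Set Implicit Arguments. Unset Strict Implicit. Unset Printing Implicit Defensive.
Import Order.TTheory GRing.Theory Num.Theory.
Local Open Scope ring_scope.

(* A Z^d-periodic graph Gamma is encoded by its fundamental graph data:
   quotient vertices 'I_nu (the vertex set V_0 of the fixed tree T),
   a finite type of oriented quotient edges A_* (arc) with source, target,
   orientation reversal and edge index tau : A_* -> Z^d.
   The periodic graph itself is V = 'I_nu * Z^d, the vertex (v, m) being v_0 + m,
   with an oriented edge (u, m) -> (v, m + tau e) for every arc e from u to v. *)
Record pgraph (d nu : nat) := PGraph {
  arc : finType;
  src : arc -> 'I_nu;
  tgt : arc -> 'I_nu;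
  rev : arc -> arc;
  tau : arc -> 'rV[int]_d }.
Arguments arc {d nu} p.
Arguments src {d nu} p _.
Arguments tgt {d nu} p _.
Arguments rev {d nu} p _.
Arguments tau {d nu} p _.

(* Each undirected edge is two oppositely oriented edges. *)
Definition wf_pgraph d nu (G : pgraph d nu) : Prop :=
  forall e : arc G, [/\ rev G (rev G e) = e, rev G e != e,
                       src G (rev G e) = tgt G e, tgt G (rev G e) = src G e &
                       tau G (rev G e) = - tau G e].

Inductive reach (T : Type) (r : T -> T -> Prop) : T -> T -> Prop :=
| reach_refl x : reach r x x
| reach_step x y z : r x y -> reach r y z -> reach r x z.

Definition lift_adj d nu (G : pgraph d nu) (x y : 'I_nu * 'rV[int]_d) : Prop :=
  exists e : arc G, [/\ src G e = x.1, tgt G e = y.1 & y.2 = x.2 + tau G e].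

Definition lift_connected d nu (G : pgraph d nu) : Prop :=
  forall x y, reach (@lift_adj d nu G) x y.

(* The vertices V_0 = {(v, 0)} span a subtree T of Gamma, i.e. the subgraph of
   Gamma induced on V_0 (whose edges are the arcs of index 0) is connected. *)
Definition base_tree_exists d nu (G : pgraph d nu) : Prop :=
  forall u v : 'I_nu,
    reach (fun a b => exists e : arc G, [/\ src G e = a, tgt G e = b & tau G e = 0]) u v.

Definition deg d nu (G : pgraph d nu) (v : 'I_nu) : nat := #|[pred e | src G e == v]|.

Section Fiber.
Variable R : realType.

Definition expi (t : R) : R[i] := (cos t +i* sin t)%C.

Definition ipz d (m : 'rV[int]_d) (th : 'rV[R]_d) : R := \sum_i (m 0 i)%:~R * th 0 i.

Definition fiberH d nu (G : pgraph d nu) (Q : 'I_nu -> R) (th : 'rV[R]_d) : 'M[R[i]]_nu :=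
  \matrix_(v, u)
    (((if v == u then 1 + Q v else 0)%:C)%C
     - \sum_(e : arc G | (src G e == v) && (tgt G e == u))
         expi (ipz (tau G e) th)
         / ((Num.sqrt ((deg G v)%:R * (deg G u)%:R))%:C)%C).

Definition lambda1 d nu (A : 'rV[R]_d -> 'M[R[i]]_nu) (th : 'rV[R]_d) : R :=
  inf [set x : R | eigenvalue (A th) ((x%:C)%C)].

Definition band_minus d (f : 'rV[R]_d -> R) : R := inf (range f).
Definition band_plus d (f : 'rV[R]_d -> R) : R := sup (range f).
Definition band_len d (f : 'rV[R]_d -> R) : R := band_plus f - band_minus f.

Definition hessian0 d (f : 'rV[R]_d -> R) : 'M[R]_d :=
  \matrix_(i, j) ('D_(delta_mx 0 i) ('D_(delta_mx 0 j) f) 0).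

Definition eff_mass d (f : 'rV[R]_d -> R) : 'M[R]_d := invmx (hessian0 f).

Definition qform d (A : 'M[R]_d) (x : 'rV[R]_d) : R := (x *m A *m x^T) 0 0.

Definition psi_minus d nu (G : pgraph d nu) (psi : 'I_nu -> R) : R :=
  inf (range (fun v => psi v / Num.sqrt (deg G v)%:R)).
Definition psi_plus d nu (G : pgraph d nu) (psi : 'I_nu -> R) : R :=
  sup (range (fun v => psi v / Num.sqrt (deg G v)%:R)).

Definition colC nu (psi : 'I_nu -> R) : 'cV[R[i]]_nu := \col_v ((psi v)%:C)%C.

End Fiber.

(* Main.v *)
(** Let psi be the Perron eigenvector of H(0), with eigenvalue l. Writing a test
    vector as u = psi g turns the Rayleigh quotient of H(theta) - l into

      (1/2) sum_e w_e |e^{i<tau_e,theta>} g(src e) - g(tgt e)|^2 / sum_v psi_v^2 |g_v|^2,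

    with w_e = psi(src e) psi(tgt e) / sqrt(deg deg). For the Laplacian psi is
    sqrt(deg), so the two quotients differ by a factor in [c0^-2, c0^2]; hence
    c0^-2 l10(theta) <= l1(theta) - l1(0) <= c0^2 l10(theta), which gives the band
    estimate. Following g along a lifted walk from v to its translate by the
    j-th basis vector gives 2 - 2 cos(theta_j) <= K l10(theta), so the band is
    nondegenerate and the Hessian of l10 at 0 is positive definite.

    Differentiability of l1 near 0 comes from the characteristic equation
    F(l1(theta), theta) = 0 and the simplicity of l1(0): along any line, F is a
    trigonometric polynomial whose increments factor through the increments of
    l1 and of the parameter. Comparing second derivatives at the common minimum
    0 bounds the Hessians by one another, and inversion reverses the order. *)

Require Import Defs.
From mathcomp Require Import all_boot all_order all_algebra.
From mathcomp Require Import complex.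
From mathcomp Require Import all_classical all_reals all_analysis.
From mathcomp Require Import perm ring lra.
Set Implicit Arguments. Unset Strict Implicit. Unset Printing Implicit Defensive.
Import Order.TTheory GRing.Theory Num.Theory.
Import numFieldNormedType.Exports.
Import Defs sesquilinear spectral.
Local Open Scope ring_scope.
Local Open Scope sesquilinear_scope.
Local Open Scope complex_scope.

(** * Spectral minimum of a Hermitian matrix *)

Definition normsq (R : realType) (z : R[i]) : R := complex.Re z ^+ 2 + complex.Im z ^+ 2.

Lemma conjCE (R : realType) (z : R[i]) : Num.conj z = conjc z.
Proof. by []. Qed.

Lemma normsqE (R : realType) (z : R[i]) : z * Num.conj z = (normsq z)%:C.
Proof. by rewrite conjCE; case: z => a b; rewrite /normsq; simpc; congr Complex; ring. Qed.

Lemma normsq_ge0 (R : realType) (z : R[i]) : 0 <= normsq z.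
Proof. by rewrite addr_ge0 // sqr_ge0. Qed.

Lemma normsq_eq0 (R : realType) (z : R[i]) : (normsq z == 0) = (z == 0).
Proof. by case: z => a b; rewrite /normsq paddr_eq0 ?sqr_ge0 //= !sqrf_eq0 eq_complex. Qed.

(** Convertible with [lambda1] at a fixed [th], so the matrix lemmas below apply to the band
    function directly. *)
Definition lmin (R : realType) n (A : 'M[R[i]]_n) : R :=
  inf [set x : R | eigenvalue A x%:C]%classic.

Section Hermitian.
Variables (R : realType) (n : nat) (A : 'M[R[i]]_n).
Hypothesis n_gt0 : (0 < n)%N.
Hypothesis Aherm : forall i j, A j i = Num.conj (A i j).

(** By the spectral theorem the real eigenvalues are exactly the finitely many [dr i], so the
    infimum in [lmin] is attained. *)
Lemma hermitian_min_spectrum :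
  exists P (dr : 'I_n -> R) i0,
    [/\ P \is unitarymx, P *m A = diag_mx (\row_i (dr i)%:C) *m P,
        forall i, dr i0 <= dr i & lmin A = dr i0].
Proof.
have AH : A \is hermsymmx.
  apply/is_hermitianmxP; rewrite expr0 scale1r; apply/matrixP => i j.
  by rewrite !mxE Aherm.
set P := spectralmx A; set D := spectral_diag A.
have PU : P \is unitarymx by exact: spectral_unitarymx.
have PN : P \in unitmx by exact: unitarymx_unit.
have /orthomx_spectralP AE := hermitian_normalmx AH.
have Dr : forall i, D 0 i = (complex.Re (D 0 i))%:C.
  by move=> i; rewrite RRe_real //; exact: (mxOverP (hermitian_spectral_diag_real AH)).
pose dr i := complex.Re (D 0 i).
have DE : diag_mx (\row_i (dr i)%:C) = diag_mx D.
  by congr diag_mx; apply/rowP => i; rewrite mxE -Dr.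
have PA : P *m A = diag_mx (\row_i (dr i)%:C) *m P.
  by rewrite DE {1}AE -/P -/D -mulmxA mulKVmx.
case: (@arg_minP _ _ _ (Ordinal n_gt0) xpredT dr isT) => i0 _ i0min.
have dmin i : dr i0 <= dr i by exact: i0min.
exists P, dr, i0; split => //.
have ev i : eigenvalue A (dr i)%:C.
  apply/eigenvalueP; exists (row i P).
    rewrite -row_mul PA; apply/rowP => j; rewrite !mxE (bigD1 i) //= big1.
      by rewrite !mxE eqxx addr0 mulr1n.
    by move=> k ki; rewrite !mxE eq_sym (negbTE ki) mulr0n mul0r.
  apply/eqP => r0; have := congr1 (fun B => row i B) (unitarymxP PU).
  rewrite row_mul r0 mul0mx => /rowP/(_ i); rewrite !mxE eqxx => /eqP.
  by rewrite eq_sym oner_eq0.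
(* In the coordinates [w] of the eigenvector the matrix is diagonal; any nonzero coordinate
   identifies the eigenvalue. *)
have evE x : eigenvalue A x%:C -> exists i, x = dr i.
  case/eigenvalueP => v vA vN0.
  pose w := v *m invmx P.
  have wN0 : w != 0.
    by apply: contra vN0 => /eqP w0; rewrite -[v](mulmxKV PN) -/w w0 mul0mx.
  have wD : w *m diag_mx (\row_i (dr i)%:C) = x%:C *: w.
    by rewrite DE /w scalemxAl -vA [in RHS]AE -/P -/D !mulmxA mulmxK.
  clearbody w; have [i wi] : exists i, w 0 i != 0 by apply/rV0Pn.
  exists i; move/rowP/(_ i): wD; rewrite mul_mx_diag !mxE mulrC.
  by move=> /(mulIf wi)/complexI.
rewrite /lmin; apply/eqP; rewrite eq_le; apply/andP; split.
  apply: ge_inf; last exact: ev.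
  by exists (dr i0) => x /evE[i ->].
apply: lb_le_inf; first by exists (dr i0); exact: ev.
by move=> x /evE[i ->].
Qed.

(** Row vectors are used because [eigenvalue] refers to left eigenvectors; for Hermitian [A] the sum
    is already real. *)
Definition hform (u : 'rV[R[i]]_n) : R :=
  complex.Re (\sum_i \sum_j u 0 i * A i j * Num.conj (u 0 j)).

Lemma hformE (u : 'rV[R[i]]_n) : hform u = complex.Re ((u *m A *m u^t* ) 0 0).
Proof.
rewrite /hform mxE; congr complex.Re; rewrite exchange_big; apply: eq_bigr => j _.
by rewrite !mxE mulr_suml; apply: eq_bigr.
Qed.

Lemma lmin_eigenvector : exists2 u : 'rV[R[i]]_n, u != 0 & u *m A = (lmin A)%:C *: u.
Proof.
have [P [dr [i0 [PU PA dmin ->]]]] := hermitian_min_spectrum.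
exists (row i0 P).
  apply/eqP => r0; have := congr1 (fun B => row i0 B) (unitarymxP PU).
  rewrite row_mul r0 mul0mx => /rowP/(_ i0); rewrite !mxE eqxx => /eqP.
  by rewrite eq_sym oner_eq0.
rewrite -row_mul PA; apply/rowP => j; rewrite !mxE (bigD1 i0) //= big1.
  by rewrite !mxE eqxx addr0 mulr1n.
by move=> k ki; rewrite !mxE eq_sym (negbTE ki) mulr0n mul0r.
Qed.

(** [c] holds the coordinates of [u] in the orthonormal eigenbasis formed by the rows of [P]; the
    second identity is Parseval's. *)
Lemma hform_diag P (dr : 'I_n -> R) (u : 'rV[R[i]]_n) : P \is unitarymx ->
  P *m A = diag_mx (\row_i (dr i)%:C) *m P ->
  let c := u *m P^t* in
  hform u = \sum_i dr i * normsq (c 0 i) /\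
  \sum_i normsq (u 0 i) = \sum_i normsq (c 0 i).
Proof.
move=> PU PA c.
have uE : u = c *m P.
  by rewrite /c -mulmxA -invmx_unitary // mulVmx ?mulmx1 // unitarymx_unit.
have sq (w : 'rV[R[i]]_n) : (\sum_i normsq (w 0 i))%:C = (w *m w^t* ) 0 0.
  rewrite mxE rmorph_sum; apply: eq_bigr => i _.
  by rewrite /= -normsqE !mxE.
split.
  rewrite hformE; have -> : u *m A *m u^t* = c *m diag_mx (\row_i (dr i)%:C) *m c^t*.
    by rewrite uE trmx_mul map_mxM !mulmxA -(mulmxA c P A) PA !mulmxA mulmxtVK.
  rewrite mxE; set s := \sum_i _; have -> : s = (\sum_i dr i * normsq (c 0 i))%:C; last by [].
  rewrite rmorph_sum; apply: eq_bigr => i _.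
  by rewrite mul_mx_diag !mxE mulrAC -/c rmorphM /= -normsqE mulrC.
apply: complexI; rewrite !sq uE trmx_mul map_mxM !mulmxA mulmxtVK //.
Qed.

Lemma lmin_le_hform (u : 'rV[R[i]]_n) : lmin A * (\sum_i normsq (u 0 i)) <= hform u.
Proof.
have [P [dr [i0 [PU PA dmin ->]]]] := hermitian_min_spectrum.
have [-> ->] := hform_diag u PU PA.
rewrite mulr_sumr ler_sum // => i _; apply: ler_wpM2r; first exact: normsq_ge0.
exact: dmin.
Qed.

Lemma lmin_hform_eq (u : 'rV[R[i]]_n) : hform u = lmin A * (\sum_i normsq (u 0 i)) ->
  u *m A = (lmin A)%:C *: u.
Proof.
have [P [dr [i0 [PU PA dmin ->]]]] := hermitian_min_spectrum.
have [-> ->] := hform_diag u PU PA; set c := u *m _ => E.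
have uE : u = c *m P.
  by rewrite /c -mulmxA -invmx_unitary // mulVmx ?mulmx1 // unitarymx_unit.
have E0 : \sum_i (dr i - dr i0) * normsq (c 0 i) = 0.
  by under eq_bigr do rewrite mulrBl; rewrite sumrB E mulr_sumr subrr.
(* A vanishing sum of nonnegative terms: [c] is supported where [dr i] equals the minimum. *)
have cD i : (dr i)%:C * c 0 i = (dr i0)%:C * c 0 i.
  have nn k : true -> 0 <= (dr k - dr i0) * normsq (c 0 k).
    by move=> _; rewrite mulr_ge0 ?normsq_ge0 // subr_ge0.
  have /eqP := psumr_eq0P nn E0 (erefl : xpredT i).
  rewrite mulf_eq0 normsq_eq0 subr_eq0 => /orP[/eqP -> //|/eqP ->].
  by rewrite !mulr0.
rewrite uE -mulmxA PA mulmxA scalemxAl; congr (_ *m _).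
by apply/rowP => i; rewrite mul_mx_diag; have := cD i; clearbody c; rewrite !mxE mulrC.

Qed.

(** Passes from geometric to algebraic simplicity: a second index with the lowest eigenvalue would
    give two orthonormal rows of [P] on one eigenline. *)
Lemma lmin_simple :
  (forall u w : 'rV[R[i]]_n, u *m A = (lmin A)%:C *: u -> w *m A = (lmin A)%:C *: w ->
     u != 0 -> exists a, w = a *: u) ->
  exists (dr : 'I_n -> R) i0,
    [/\ char_poly A = \prod_i ('X - ((dr i)%:C)%:P), lmin A = dr i0 &
        forall i, i != i0 -> dr i != dr i0].
Proof.
have [P [dr [i0 [PU PA dmin ->]]]] := hermitian_min_spectrum => simp.
exists dr, i0; split => //.
  have PN : P \in unitmx by exact: unitarymx_unit.
  have -> : A = invmx P *m diag_mx (\row_i (dr i)%:C) *m P.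
    by rewrite -mulmxA -PA mulKmx.
  rewrite /char_poly /char_poly_mx.
  pose X : 'M[{poly R[i]}]_n := map_mx polyC P.
  have XX : map_mx polyC (invmx P) *m X = 1%:M by rewrite -map_mxM mulVmx // map_mx1.
  have -> : 'X%:M - map_mx polyC (invmx P *m diag_mx (\row_i (dr i)%:C) *m P)
    = map_mx polyC (invmx P) *m ('X%:M - map_mx polyC (diag_mx (\row_i (dr i)%:C))) *m X.
    by rewrite mulmxBr mulmxBl !map_mxM scalar_mxC -(mulmxA 'X%:M) XX mulmx1.
  rewrite !det_mulmx mulrAC -det_mulmx XX det1 mul1r.
  rewrite map_diag_mx.
  have -> : 'X%:M - diag_mx (map_mx polyC (\row_i (dr i)%:C)) =
    diag_mx (\row_i ('X - ((dr i)%:C)%:P)).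
    by apply/matrixP => i j; rewrite !mxE -mulrnBl.
  by rewrite det_diag; apply: eq_bigr => i _; rewrite mxE.
move=> i ii0; apply/eqP => die.
have rowE k : row k P *m A = (dr k)%:C *: row k P.
  rewrite -row_mul PA; apply/rowP => j; rewrite !mxE (bigD1 k) //= big1.
    by rewrite !mxE eqxx addr0 mulr1n.
  by move=> l lk; rewrite !mxE eq_sym (negbTE lk) mulr0n mul0r.
have dotP k l : row k P *m (row l P)^t* = (k == l)%:R%:M.
  have /matrixP/(_ k l) := unitarymxP PU; rewrite !mxE => E.
  apply/matrixP => a b; rewrite !ord1 !mxE eqxx mulr1n -E.
  by apply: eq_bigr => j _; rewrite !mxE.
have r0 : row i0 P != 0.
  apply/eqP => r0; have := dotP i0 i0; rewrite r0 mul0mx eqxx => /matrixP/(_ 0 0).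
  by rewrite !mxE eqxx mulr1n => /eqP; rewrite eq_sym oner_eq0.
have [||a aE] := simp (row i0 P) (row i P) _ _ r0; rewrite ?rowE ?die //.
have a0 : a = 0.
  have := dotP i i0; rewrite aE -scalemxAl dotP (negbTE ii0) eqxx => /matrixP/(_ 0 0).
  by rewrite !mxE eqxx !mulr1n mulr1.
have := dotP i i; rewrite aE a0 scale0r mul0mx eqxx => /matrixP/(_ 0 0).
by rewrite !mxE eqxx mulr1n => /eqP; rewrite eq_sym oner_eq0.
Qed.

End Hermitian.

(** * Trigonometric expressions and implicit derivatives *)

Section Slopes.
Local Open Scope classical_set_scope.
Variable R : realType.

Lemma is_derive_slope (V : normedModType R) (f : V -> R) (a v : V) (df : R) :
  is_derive a v f df <->
  (h^-1 * (f (h *: v + a) - f a) @[h --> 0^'] --> df).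
Proof.
split=> [[fd <-]|fc]; first exact: fd.
apply: DeriveDef; first by apply/cvg_ex; exists df.
by apply: cvg_lim.
Qed.

Lemma cvg_near_eq (f g : R -> R) (l : R) :
  {near 0^', f =1 g} -> g h @[h --> 0^'] --> l -> f h @[h --> 0^'] --> l.
Proof. by move=> fg; apply: cvg_trans; apply: near_eq_cvg; apply: filterS fg => h ->. Qed.

Lemma cvg_neq0_eq (f g : R -> R) (l : R) :
  (forall h, h != 0 -> f h = g h) ->
  g h @[h --> 0^'] --> l -> f h @[h --> 0^'] --> l.
Proof.
move=> fg; apply: cvg_near_eq; near=> h; apply: fg; near: h.
exact: nbhs_dnbhs_neq.
Unshelve. all: by end_near. Qed.

Variable d : nat.

(* Polynomial in mu, trigonometric in theta: closed under both formal derivatives. *)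
Inductive texp :=
| TConst of R
| TMu
| TCos of 'rV[int]_d
| TSin of 'rV[int]_d
| TAdd of texp & texp
| TMul of texp & texp.

Fixpoint teval (e : texp) (mu : R) (th : 'rV[R]_d) : R :=
  match e with
  | TConst c => c
  | TMu => mu
  | TCos m => cos (ipz m th)
  | TSin m => sin (ipz m th)
  | TAdd e1 e2 => teval e1 mu th + teval e2 mu th
  | TMul e1 e2 => teval e1 mu th * teval e2 mu th
  end.

Fixpoint dmu (e : texp) : texp :=
  match e with
  | TMu => TConst 1
  | TAdd e1 e2 => TAdd (dmu e1) (dmu e2)
  | TMul e1 e2 => TAdd (TMul (dmu e1) e2) (TMul e1 (dmu e2))
  | _ => TConst 0
  end.

Fixpoint dth (x : 'rV[R]_d) (e : texp) : texp :=
  match e with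
  | TCos m => TMul (TConst (- ipz m x)) (TSin m)
  | TSin m => TMul (TConst (ipz m x)) (TCos m)
  | TAdd e1 e2 => TAdd (dth x e1) (dth x e2)
  | TMul e1 e2 => TAdd (TMul (dth x e1) e2) (TMul e1 (dth x e2))
  | _ => TConst 0
  end.

Lemma ipz_line (m : 'rV[int]_d) (x th : 'rV[R]_d) t :
  ipz m (t *: x + th) = t * ipz m x + ipz m th.
Proof.
rewrite /ipz mulr_sumr -big_split; apply: eq_bigr => i _ /=.
by rewrite !mxE; ring.
Qed.

Lemma ipz0 (m : 'rV[int]_d) : ipz m (0 : 'rV[R]_d) = 0.
Proof. by rewrite /ipz big1 // => i _; rewrite mxE mulr0. Qed.

Lemma slope_affine (f f' : R -> R) (a b : R) :
  (forall y : R, is_derive y (1 : R) f (f' y)) ->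
  h^-1 * (f (h * a + b) - f b) @[h --> 0^'] --> a * f' b.
Proof.
move=> fd.
have : is_derive (0 : R) 1 (f \o (fun t => t * a + b)) (f' (0 * a + b) * a).
  apply: is_derive1_comp.
  apply/is_derive_slope; apply: (@cvg_neq0_eq _ (fun=> a)) => [h h0|]; last exact: cvg_cst.
  by rewrite addr0 /GRing.scale /=; field.
move/is_derive_slope => /=; rewrite mul0r add0r mulrC.
by under eq_fun => h do rewrite addr0 /GRing.scale /= mulr1.
Qed.

(* Only continuity of mu is assumed, so the factorisation can be solved for the
   difference quotient of mu: this plays the role of the implicit function theorem. *)
Lemma texp_slope (e : texp) (mu : R -> R) (mu0 : R) (th x : 'rV[R]_d) :
  mu h @[h --> 0^'] --> mu0 ->
  exists K L : R -> R,
    [/\ K h @[h --> 0^'] --> teval (dmu e) mu0 th,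
        L h @[h --> 0^'] --> teval (dth x e) mu0 th &
        forall h, h != 0 ->
          teval e (mu h) (h *: x + th) - teval e mu0 th =
            (mu h - mu0) * K h + h * L h].
Proof.
move=> muc; elim: e => [c||m|m|e1 IH1 e2 IH2|e1 IH1 e2 IH2] /=.
- exists (fun=> 0), (fun=> 0); split; [exact: cvg_cst|exact: cvg_cst|].
  by move=> h _; ring.
- exists (fun=> 1), (fun=> 0); split; [exact: cvg_cst|exact: cvg_cst|].
  by move=> h _; ring.
- exists (fun=> 0), (fun h => h^-1 * (cos (h * ipz m x + ipz m th) - cos (ipz m th))).
  split; [exact: cvg_cst| |].
    by rewrite mulNr -mulrN; exact: (@slope_affine cos (fun y => - sin y) _ _ (@is_derive_cos R)).
  by move=> h h0; rewrite ipz_line; field.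
- exists (fun=> 0), (fun h => h^-1 * (sin (h * ipz m x + ipz m th) - sin (ipz m th))).
  split; [exact: cvg_cst| |].
    exact: (@slope_affine sin cos _ _ (@is_derive_sin R)).
  by move=> h h0; rewrite ipz_line; field.
- case: IH1 => K1 [L1 [K1c L1c E1]]; case: IH2 => K2 [L2 [K2c L2c E2]].
  exists (fun h => K1 h + K2 h), (fun h => L1 h + L2 h); split; [exact: cvgD|exact: cvgD|].
  by move=> h h0; rewrite opprD addrACA E1 // E2 //; ring.
- case: IH1 => K1 [L1 [K1c L1c E1]]; case: IH2 => K2 [L2 [K2c L2c E2]].
  (* For [h != 0] this is the second factor at the displaced point, written so that its limit
     follows from those of [K2] and [L2]. *)
  pose E h := (mu h - mu0) * K2 h + h * L2 h + teval e2 mu0 th.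
  have hc : h @[h --> (0:R)^'] --> (0:R) by exact: cvg_within.
  have Ec : E h @[h --> 0^'] --> teval e2 mu0 th.
    rewrite -[X in _ --> X]add0r; apply: cvgD; last exact: cvg_cst.
    rewrite -[X in _ --> X](addr0 0); apply: cvgD.
      rewrite -[X in _ --> X](mul0r (teval (dmu e2) mu0 th)); apply: cvgM => //.
      by rewrite -[X in _ --> X](subrr mu0); apply: cvgB => //; exact: cvg_cst.
    by rewrite -[X in _ --> X](mul0r (teval (dth x e2) mu0 th)); apply: cvgM.
  exists (fun h => K1 h * E h + teval e1 mu0 th * K2 h),
         (fun h => L1 h * E h + teval e1 mu0 th * L2 h); split.
  + by apply: cvgD; apply: cvgM => //; exact: cvg_cst.
  + by apply: cvgD; apply: cvgM => //; exact: cvg_cst.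
  move=> h h0; rewrite /E -E2 // subrK.
  transitivity ((teval e1 (mu h) (h *: x + th) - teval e1 mu0 th) * teval e2 (mu h) (h *: x + th)
    + teval e1 mu0 th * (teval e2 (mu h) (h *: x + th) - teval e2 mu0 th)); first by ring.
  by rewrite E1 // E2 //; ring.
Qed.

Lemma texp_cvg (e : texp) (mu : R -> R) (mu0 : R) (th x : 'rV[R]_d) :
  mu h @[h --> 0^'] --> mu0 ->
  teval e (mu h) (h *: x + th) @[h --> 0^'] --> teval e mu0 th.
Proof.
move=> muc; have [K [L [Kc Lc E]]] := texp_slope e th x muc.
have hc : h @[h --> (0:R)^'] --> (0:R) by exact: cvg_within.
apply: (@cvg_neq0_eq _ (fun h => (mu h - mu0) * K h + h * L h + teval e mu0 th)).
  by move=> h h0; rewrite -E ?subrK.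
rewrite -[X in _ --> X]add0r; apply: cvgD; last exact: cvg_cst.
rewrite -[X in _ --> X](addr0 0); apply: cvgD.
  rewrite -[X in _ --> X](mul0r (teval (dmu e) mu0 th)); apply: cvgM => //.
  by rewrite -[X in _ --> X](subrr mu0); apply: cvgB => //; exact: cvg_cst.
by rewrite -[X in _ --> X](mul0r (teval (dth x e) mu0 th)); apply: cvgM.
Qed.

Lemma texp_deriv (e : texp) (mu : R -> R) (mu0 mu1 : R) (th x : 'rV[R]_d) :
  h^-1 * (mu h - mu0) @[h --> 0^'] --> mu1 ->
  h^-1 * (teval e (mu h) (h *: x + th) - teval e mu0 th) @[h --> 0^'] -->
    mu1 * teval (dmu e) mu0 th + teval (dth x e) mu0 th.
Proof.
move=> mud.
have hc : h @[h --> (0:R)^'] --> (0:R) by exact: cvg_within.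
have muc : mu h @[h --> 0^'] --> mu0.
  apply: (@cvg_neq0_eq _ (fun h => h * (h^-1 * (mu h - mu0)) + mu0)) => [h h0|].
    by rewrite mulVKf // subrK.
  rewrite -[X in _ --> X]add0r; apply: cvgD; last exact: cvg_cst.
  by rewrite -[X in _ --> X](mul0r mu1); apply: cvgM.
have [K [L [Kc Lc E]]] := texp_slope e th x muc.
apply: (@cvg_neq0_eq _ (fun h => h^-1 * (mu h - mu0) * K h + L h)) => [h h0|].
  by rewrite E //; field.
by apply: cvgD => //; apply: cvgM.
Qed.

(** Along the curve both values vanish, so [texp_slope] reads [(mu h - mu0) * K h + h * L h = 0];
    solving for the quotient needs [K h] nonzero near 0, which its limit ensures. *)
Lemma texp_implicit (e : texp) (mu : R -> R) (mu0 : R) (th x : 'rV[R]_d) :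
  mu h @[h --> 0^'] --> mu0 ->
  (forall h, h != 0 -> teval e (mu h) (h *: x + th) = 0) -> teval e mu0 th = 0 ->
  teval (dmu e) mu0 th != 0 ->
  h^-1 * (mu h - mu0) @[h --> 0^'] -->
    - (teval (dth x e) mu0 th / teval (dmu e) mu0 th).
Proof.
move=> muc e0 e00 dN0; have [K [L [Kc Lc E]]] := texp_slope e th x muc.
apply: (@cvg_near_eq _ (fun h => - (L h / K h))); last first.
  by apply: cvgN; apply: cvgM => //; exact: cvgV.
near=> h; have h0 : h != 0 by near: h; exact: nbhs_dnbhs_neq.
have K0 : K h != 0 by near: h; exact: (cvgr_neq0 _ Kc).
have := E h h0; rewrite e0 // e00 subr0 => /esym/eqP; rewrite addr_eq0 => /eqP EE.
rewrite -[mu h - mu0](mulfK K0) EE; field.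
by rewrite h0 K0.
Unshelve. all: by end_near. Qed.

(** Mixed partial derivatives commute already at the level of expressions; the symmetry of the
    Hessian rests on this. *)
Lemma dthC (e : texp) (x y : 'rV[R]_d) mu th :
  teval (dth x (dth y e)) mu th = teval (dth y (dth x e)) mu th.
Proof.
by elim: e => [c||m|m|e1 IH1 e2 IH2|e1 IH1 e2 IH2] //=; rewrite ?IH1 ?IH2; ring.
Qed.

End Slopes.

(** * Second derivatives at a minimum *)

Section SecondOrder.
Local Open Scope classical_set_scope.
Variable R : realType.

(** Intended for a critical point at 0: the quotient of [dg] omits the term [dg 0]. *)
Definition second_deriv0 (g : R -> R) (a : R) :=
  exists dg : R -> R,
    (\forall t \near (0 : R), is_derive t (1 : R) g (dg t)) /\
    h^-1 * dg h @[h --> 0^'] --> a.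

Lemma second_deriv0_comb (g1 g2 : R -> R) a1 a2 c : second_deriv0 g1 a1 -> second_deriv0 g2 a2 ->
  second_deriv0 (fun t => c * g1 t - g2 t) (c * a1 - a2).
Proof.
move=> [d1 [D1 L1]] [d2 [D2 L2]].
exists (fun t => c * d1 t - d2 t); split.
  near=> t.
  have E1 : is_derive t (1 : R) g1 (d1 t) by near: t.
  have E2 : is_derive t (1 : R) g2 (d2 t) by near: t.
  exact: (is_deriveB (is_deriveZ c E1) E2).
have -> : (fun h => h^-1 * (c * d1 h - d2 h)) = (fun h => c * (h^-1 * d1 h) - h^-1 * d2 h).
  by apply/funext => h; ring.
by apply: cvgB => //; apply: cvgM => //; exact: cvg_cst.
Unshelve. all: by end_near. Qed.

(** If [a] were negative, [dg] would be negative just right of 0 and the mean value theorem would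
    push [g] below 0. *)
Lemma second_deriv0_ge0 (g : R -> R) a : second_deriv0 g a -> g 0 = 0 -> (forall t, 0 <= g t) -> 0 <= a.
Proof.
move=> [dg [D L]] g0 gpos; rewrite leNgt; apply/negP => a0.
have N : \forall h \near (0 : R)^', h^-1 * dg h < 0 by exact: (cvgr_lt _ L).
have DN : \forall t \near (0 : R),
    is_derive t (1 : R) g (dg t) /\ (t != 0 -> t^-1 * dg t < 0).
  by apply: filterI D _; move: N; rewrite /dnbhs /within.
have [e /= e0 be] := proj1 (nbhs_ballP _ _) DN.
have e20 : 0 < e / 2 by rewrite divr_gt0.
have inb t : 0 <= t <= e / 2 -> is_derive t (1 : R) g (dg t) /\ (t != 0 -> t^-1 * dg t < 0).
  move=> /andP[t0 te]; apply: be; rewrite /ball /= sub0r normrN ger0_norm //.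
  by apply: le_lt_trans te _; lra.
have [||c] := @MVT R g dg 0 (e / 2) e20.
- by move=> x; rewrite in_itv /= => /andP[x0 xe]; case: (inb x _) => //; rewrite !ltW.
- apply: derivable_within_continuous => x; rewrite in_itv /= => xI.
  by have [[]] := inb x xI.
rewrite in_itv /= => /andP[c0 ce]; rewrite g0 !subr0 => gE.
have [_] := inb c (introT andP (conj (ltW c0) (ltW ce))).
rewrite gt_eqF // pmulr_rlt0 ?invr_gt0 // => /(_ isT) dc.
by have := gpos (e / 2); rewrite gE pmulr_lge0 // leNgt dc.
Qed.

(** Serves the explicit minorant that makes the Hessian of the Laplacian's band function positive
    definite. *)
Lemma second_deriv0_cos (a c : R) : second_deriv0 (fun t => c * (2 - 2 * cos (t * a))) (c * (2 * a ^+ 2)).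
Proof.
exists (fun t => c * (2 * a * sin (t * a))); split.
  apply: (filterE (F := nbhs (0 : R))) => t; apply/is_derive_slope.
  have := @slope_affine R cos (fun y => - sin y) a (t * a) (@is_derive_cos R).
  move=> L; have -> : c * (2 * a * sin (t * a)) = (- (c * 2)) * (a * - sin (t * a)) by ring.
  have -> : (fun h : R => h^-1 * (c * (2 - 2 * cos ((h *: 1 + t) * a)) - c * (2 - 2 * cos (t * a))))
    = (fun h => (- (c * 2)) * (h^-1 * (cos (h * a + t * a) - cos (t * a)))).
    apply/funext => h; have -> : (h *: 1 + t) * a = h * a + t * a.
      by rewrite /GRing.scale /=; ring.
    by ring.
  by apply: cvgM => //; exact: cvg_cst.
have := @slope_affine R sin cos a 0 (@is_derive_sin R); rewrite cos0 sin0 mulr1 => L.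
have -> : c * (2 * a ^+ 2) = (c * (2 * a)) * a by ring.
have -> : (fun h => h^-1 * (c * (2 * a * sin (h * a)))) =
  (fun h => (c * (2 * a)) * (h^-1 * (sin (h * a + 0) - 0))).
  by apply/funext => h; rewrite addr0; ring.
by apply: cvgM => //; exact: cvg_cst.
Qed.

(** Fermat's argument: the difference quotient is nonnegative for [h > 0] and nonpositive for
    [h < 0]. *)
Lemma slope_at_min (f : R -> R) (f0 D : R) :
  h^-1 * (f h - f0) @[h --> 0^'] --> D -> (forall h, f0 <= f h) -> D = 0.
Proof.
move=> L fmin.
(* [key] extracts from a punctured neighbourhood a point on the side chosen by the sign [e]. *)
have key (e : R) (P : R -> Prop) : (e == 1) || (e == -1) ->
    (\forall h \near (0 : R)^', P h) -> exists h, 0 < e * h /\ P h.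
  move=> e1; rewrite /dnbhs /within /= => /nbhs_ballP[r /= r0 br].
  have [re hn] : 0 < e * (e * (r / 2)) /\ `|e * (r / 2)| = r / 2.
    have r20 : 0 < r / 2 by rewrite divr_gt0.
    by case/orP: e1 => /eqP ->; rewrite ?mul1r ?mulN1r ?opprK ?normrN gtr0_norm.
  exists (e * (r / 2)); split => //; apply: br.
    by rewrite /ball /= sub0r normrN hn; lra.
  by rewrite -normr_eq0 hn gt_eqF // divr_gt0.
apply/eqP; rewrite eq_le !leNgt; apply/andP; split; apply/negP => D0.
  have [||h [h0 hD]] := key (-1) (fun h => 0 < h^-1 * (f h - f0)).
  - by rewrite eqxx orbT.
  - exact: (cvgr_gt _ L).
  have hn : h < 0 by lra.
  by move: hD; rewrite nmulr_rgt0 ?invr_lt0 // subr_lt0 ltNge fmin.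
have [||h [h0 hD]] := key 1 (fun h => h^-1 * (f h - f0) < 0).
- by rewrite eqxx.
- exact: (cvgr_lt _ L).
rewrite mul1r in h0.
by move: hD; rewrite pmulr_rlt0 ?invr_gt0 // subr_lt0 ltNge fmin.
Qed.

Variable d : nat.

Lemma ipz_basis (m : 'rV[int]_d) (x : 'rV[R]_d) :
  ipz m x = \sum_i x 0 i * ipz m (delta_mx 0 i : 'rV[R]_d).
Proof.
rewrite {1}/ipz; apply: eq_bigr => i _; rewrite /ipz (bigD1 i) //= big1 => [|j ji].
  by rewrite mxE !eqxx mulr1 addr0 mulrC.
by rewrite mxE (negbTE ji) andbF mulr0.
Qed.

(** Linearity in the direction ties the Hessian, built from coordinate directions, to second
    derivatives along arbitrary lines. *)
Lemma dth_basis (e : texp R d) (x : 'rV[R]_d) mu th :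
  teval (dth x e) mu th = \sum_i x 0 i * teval (dth (delta_mx 0 i) e) mu th.
Proof.
elim: e => [c||m|m|e1 IH1 e2 IH2|e1 IH1 e2 IH2] /=.
- by rewrite big1 // => i _; rewrite mulr0.
- by rewrite big1 // => i _; rewrite mulr0.
- rewrite ipz_basis mulNr mulr_suml -sumrN.
  by apply: eq_bigr => i _; ring.
- by rewrite ipz_basis mulr_suml; apply: eq_bigr => i _; ring.
- by rewrite IH1 IH2 -big_split; apply: eq_bigr => i _ /=; ring.
- rewrite IH1 IH2 mulr_suml mulr_sumr -big_split.
  by apply: eq_bigr => i _ /=; ring.
Qed.

Lemma qformE (A : 'M[R]_d) (x : 'rV[R]_d) :
  qform A x = \sum_i \sum_j x 0 i * x 0 j * A i j.
Proof.
rewrite /qform mxE exchange_big; apply: eq_bigr => j _.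
by rewrite !mxE mulr_suml; apply: eq_bigr => i _; ring.
Qed.

(** * Derivatives of a simple root at its minimum *)

Section SimpleRoot.
Variables (F : texp R d) (l : 'rV[R]_d -> R).
Hypothesis F0 : forall th, teval F (l th) th = 0.
Hypothesis lc : forall th x : 'rV[R]_d, l (h *: x + th) @[h --> (0 : R)^'] --> l th.
Hypothesis Fmu : teval (dmu F) (l 0) 0 != 0.
Hypothesis lmin0 : forall th, l 0 <= l th.

Let den th := teval (dmu F) (l th) th.
Let num x th := teval (dth x F) (l th) th.

Lemma root_is_derive th x : den th != 0 -> is_derive th x l (- (num x th / den th)).
Proof.
move=> dN0; apply/is_derive_slope.
by apply: (texp_implicit (e := F)) => //.
Qed.

Lemma root_num0 x : num x 0 = 0.
Proof.
have := root_is_derive x Fmu; move/is_derive_slope/slope_at_min.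
move=> /(_ (fun h => lmin0 _)) /eqP; rewrite oppr_eq0 mulf_eq0 invr_eq0.
by rewrite (negbTE Fmu) orbF => /eqP.
Qed.

(** Follows from continuity of [l] along lines through 0; such lines suffice, since all derivatives
    taken are directional. *)
Lemma root_den_near y : \forall h \near (0 : R), den (h *: y) != 0.
Proof.
have := @texp_cvg R d (dmu F) _ _ 0 y (@lc 0 y) => L.
have : \forall h \near (0 : R)^', den (h *: y) != 0.
  by apply: filterS (cvgr_neq0 _ L Fmu) => h; rewrite /den addr0.
rewrite /dnbhs /within /= => /nbhs_ballP[r /= r0 br]; apply/nbhs_ballP; exists r => // h /br H.
by have [->|] := eqVneq h 0; [rewrite scale0r|exact: H].
Qed.

(** Second derivative of an implicit function at a critical point: the terms of the general formula
    that carry a first derivative of [l] vanish at 0. *)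
Let hess x y := - (teval (dth x (dth y F)) (l 0) 0 / teval (dmu F) (l 0) 0).

(** The numerator vanishes at 0, so its slope over the limit of the denominator gives the result
    without a quotient rule. *)
Lemma root_slope2 x y :
  h^-1 * - (num y (h *: x) / den (h *: x)) @[h --> 0^'] --> hess x y.
Proof.
have Lnum : h^-1 * (num y (h *: x) - 0) @[h --> 0^'] -->
    teval (dth x (dth y F)) (l 0) 0.
  have := is_derive_slope l 0 x (- (num x 0 / den 0)).
  case=> /(_ (root_is_derive x Fmu)) + _.
  move=> /(@texp_deriv R d (dth y F) _ _ _ 0 x).
  rewrite root_num0 mul0r oppr0 mul0r add0r => L.
  apply: cvg_neq0_eq L => h _; have := root_num0 y; rewrite /num => ->.
  by rewrite !addr0 subr0.
have Lden : den (h *: x) @[h --> 0^'] --> den 0.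
  have L := @texp_cvg R d (dmu F) _ _ 0 x (@lc 0 x).
  by apply: cvg_neq0_eq L => h _; rewrite addr0.
have -> : (fun h => h^-1 * - (num y (h *: x) / den (h *: x))) =
          (fun h => - (h^-1 * (num y (h *: x) - 0) / den (h *: x))).
  by apply/funext => h; ring.
by apply: cvgN; apply: cvgM => //; exact: cvgV.
Qed.

Lemma root_hessianE i j : hessian0 l i j = hess (delta_mx 0 i) (delta_mx 0 j).
Proof.
rewrite mxE; apply: derive_val; apply/is_derive_slope.
apply: (cvg_near_eq _ (@root_slope2 (delta_mx 0 i) (delta_mx 0 j))).
have D th : den th != 0 -> 'D_(delta_mx 0 j) l th = - (num (delta_mx 0 j) th / den th).
  by move=> dth0; apply: derive_val; exact: root_is_derive.
rewrite (D 0 Fmu) root_num0 mul0r oppr0.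
(* The formula for the inner derivative holds only where [den] is nonzero, hence near 0 along the
   outer direction. *)
have N : \forall h \near (0 : R)^', den (h *: delta_mx 0 i) != 0.
  by apply: nbhs_dnbhs; exact: root_den_near.
by apply: filterS N => h dh; rewrite addr0 D // subr0.
Qed.

Lemma root_hessian_sym : (hessian0 l)^T = hessian0 l.
Proof. by apply/matrixP => i j; rewrite mxE !root_hessianE /hess dthC. Qed.

Lemma root_hessian_qform x : qform (hessian0 l) x = hess x x.
Proof.
rewrite qformE /hess dth_basis -mulNr -sumrN mulr_suml; apply: eq_bigr => i _.
rewrite dthC dth_basis mulr_sumr -sumrN mulr_suml; apply: eq_bigr => j _.
by rewrite root_hessianE /hess dthC; ring.
Qed.

Lemma root_second_deriv0 x : second_deriv0 (fun t => l (t *: x) - l 0) (qform (hessian0 l) x).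
Proof.
rewrite root_hessian_qform; exists (fun t => - (num x (t *: x) / den (t *: x))); split.
  apply: filterS (root_den_near x) => t dt; apply/is_derive_slope.
  have /is_derive_slope L := root_is_derive x dt.
  apply: cvg_neq0_eq L => h _; rewrite -scalerDl.
  have -> : h *: (1 : R) = h by rewrite /GRing.scale /= mulr1.
  by ring.
exact: root_slope2.
Qed.

End SimpleRoot.
End SecondOrder.

(** * Quadratic forms and matrix inversion *)

Section QuadraticForms.
Variables (R : realType) (d : nat).

(* From x A^-1 x^T >= 2 x z^T - z A z^T with z = k^-1 x B^-1. *)
Lemma qform_inv_le (A B : 'M[R]_d) (k : R) : A^T = A -> B^T = B ->
  A \in unitmx -> B \in unitmx -> 0 < k -> (forall x, 0 <= qform A x) ->
  (forall x, qform A x <= k * qform B x) ->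
  forall x, qform (invmx B) x <= k * qform (invmx A) x.
Proof.
move=> As Bs Au Bu k0 A0 AB x.
have iAs : (invmx A)^T = invmx A by rewrite trmx_inv As.
have iBs : (invmx B)^T = invmx B by rewrite trmx_inv Bs.
pose w := x *m invmx B; pose y := x *m invmx A.
have qw : qform B w = qform (invmx B) x.
  by rewrite /qform /w trmx_mul iBs mulmxKV // mulmxA.
have qy : qform A y = qform (invmx A) x.
  by rewrite /qform /y trmx_mul iAs mulmxKV // mulmxA.
have wy : (w *m A *m y^T) 0 0 = qform (invmx B) x.
  by rewrite /qform /y trmx_mul iAs !mulmxA mulmxK.
have yw : (y *m A *m w^T) 0 0 = qform (invmx B) x.
  by rewrite /qform /y /w trmx_mul iBs mulmxKV // mulmxA.
have := A0 (k^-1 *: w - y).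
have -> : qform A (k^-1 *: w - y) =
    k^-1 ^+ 2 * qform A w - k^-1 * (w *m A *m y^T) 0 0 - k^-1 * (y *m A *m w^T) 0 0 + qform A y.
  rewrite /qform linearB linearZ /= !(mulmxBl, mulmxBr) -!(scalemxAl, scalemxAr).
  by rewrite !mxE; ring.
rewrite wy yw qy => q0.
have := AB w; rewrite qw => qAB.
have : k^-1 ^+ 2 * qform A w <= k^-1 * qform (invmx B) x.
  rewrite expr2 -mulrA; apply: ler_wpM2l; first by rewrite invr_ge0 ltW.
  by rewrite mulrC ler_pdivrMr // mulrC.
move=> q1; have : 0 <= qform (invmx A) x - k^-1 * qform (invmx B) x by lra.
by rewrite subr_ge0 mulrC ler_pdivrMr // mulrC.
Qed.

(** On a vector of the left kernel the form would vanish. *)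
Lemma qform_pos_unitmx (A : 'M[R]_d) : (forall x, x != 0 -> 0 < qform A x) -> A \in unitmx.
Proof.
move=> pos; rewrite -row_free_unit -kermx_eq0; apply/rowV0P => v /sub_kermxP vA.
apply/eqP/negPn/negP => /pos; rewrite /qform vA mul0mx mxE ltxx //.
Qed.

End QuadraticForms.

(** * The characteristic polynomial as a trigonometric expression *)

Section CharPolyTexp.
Variables (R : realType) (d : nat).

(** As [texp] is real valued, the real and imaginary parts get separate expressions, chosen
    uniformly in [mu] and [th]. *)
Definition trigC (F : R -> 'rV[R]_d -> R[i]) :=
  exists e1 e2 : texp R d, forall mu th, F mu th = teval e1 mu th +i* teval e2 mu th.

Lemma trigC_ext F F' : trigC F -> (forall mu th, F' mu th = F mu th) -> trigC F'.
Proof. by move=> [e1 [e2 E]] EE; exists e1, e2 => mu th; rewrite EE. Qed.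

Lemma trigC_const (c : R[i]) : trigC (fun _ _ => c).
Proof. by case: c => a b; exists (TConst _ a), (TConst _ b). Qed.

Lemma trigC_mu : trigC (fun mu _ => mu%:C).
Proof. by exists (TMu _ _), (TConst _ 0). Qed.

Lemma trigC_expi m : trigC (fun _ th => expi (ipz m th)).
Proof. by exists (TCos _ m), (TSin _ m). Qed.

Lemma trigC_add F F' : trigC F -> trigC F' -> trigC (fun mu th => F mu th + F' mu th).
Proof.
move=> [a1 [a2 Ea]] [b1 [b2 Eb]]; exists (TAdd a1 b1), (TAdd a2 b2) => mu th.
by rewrite Ea Eb.
Qed.

Lemma trigC_mul F F' : trigC F -> trigC F' -> trigC (fun mu th => F mu th * F' mu th).
Proof.
move=> [a1 [a2 Ea]] [b1 [b2 Eb]].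
exists (TAdd (TMul a1 b1) (TMul (TConst _ (-1)) (TMul a2 b2))), (TAdd (TMul a1 b2) (TMul a2 b1)).
by move=> mu th; rewrite Ea Eb /=; simpc; congr Complex; ring.
Qed.

Lemma trigC_sum (I : Type) (r : seq I) (P : pred I) (F : I -> R -> 'rV[R]_d -> R[i]) :
  (forall i, trigC (F i)) -> trigC (fun mu th => \sum_(i <- r | P i) F i mu th).
Proof.
move=> FT; elim: r => [|i r IH].
  by apply: (trigC_ext (trigC_const 0)) => mu th; rewrite big_nil.
case Pi: (P i).
  by apply: (trigC_ext (trigC_add (FT i) IH)) => mu th; rewrite big_cons Pi.
by apply: (trigC_ext IH) => mu th; rewrite big_cons Pi.
Qed.

Lemma trigC_prod (I : Type) (r : seq I) (P : pred I) (F : I -> R -> 'rV[R]_d -> R[i]) :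
  (forall i, trigC (F i)) -> trigC (fun mu th => \prod_(i <- r | P i) F i mu th).
Proof.
move=> FT; elim: r => [|i r IH].
  by apply: (trigC_ext (trigC_const 1)) => mu th; rewrite big_nil.
case Pi: (P i).
  by apply: (trigC_ext (trigC_mul (FT i) IH)) => mu th; rewrite big_cons Pi.
by apply: (trigC_ext IH) => mu th; rewrite big_cons Pi.
Qed.

Lemma horner_char_poly n (A : 'M[R[i]]_n) x : (char_poly A).[x] = \det (x%:M - A).
Proof.
rewrite -horner_evalE /char_poly -det_map_mx; congr (\det _); apply/matrixP => i j.
by rewrite !mxE /= horner_evalE !hornerE hornerMn hornerX.
Qed.

Lemma trigC_char_poly nu (G : pgraph d nu) (Q : 'I_nu -> R) :
  trigC (fun mu th => (char_poly (fiberH G Q th)).[mu%:C]).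
Proof.
pose f (i j : 'I_nu) mu th := (mu%:C%:M - fiberH G Q th) i j.
have fT i j : trigC (f i j).
  have T1 : trigC (fun mu _ => (i == j)%:R * mu%:C) := trigC_mul (trigC_const _) trigC_mu.
  have T2 : trigC (fun mu th => \sum_(e : arc G | (src G e == i) && (tgt G e == j))
         expi (ipz (tau G e) th) * (((Num.sqrt ((deg G i)%:R * (deg G j)%:R))%:C)%C)^-1).
    by apply: trigC_sum => e; apply: trigC_mul (trigC_expi _) (trigC_const _).
  have T3 := trigC_add (trigC_add T1 (trigC_const (- ((if i == j then 1 + Q i else 0)%:C)))) T2.
  by apply: (trigC_ext T3) => mu th; rewrite /f !mxE [_%:R * mu%:C]mulr_natl opprD opprK addrA.
(* Leibniz expansion: the determinant is a finite sum of products of entries, each affine in [mu]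
   and trigonometric in [th]. *)
apply: (@trigC_ext (fun mu th => \sum_(s : 'S_nu) (-1) ^+ s * \prod_i f i (s i) mu th)).
  apply: trigC_sum => s; apply: trigC_mul (trigC_const _) _.
  by apply: trigC_prod => i.
by move=> mu th; rewrite horner_char_poly.
Qed.

Lemma prod_cvg (I : Type) (r : seq I) (P : pred I) (c : I -> R) (a : R) :
  (\prod_(i <- r | P i) (a + h - c i) @[h --> (0:R)^'] --> \prod_(i <- r | P i) (a - c i))%classic.
Proof.
have hc : (h @[h --> (0:R)^'] --> (0:R))%classic by exact: cvg_within.
elim: r => [|i r IH].
  by under eq_fun do rewrite big_nil; rewrite big_nil; exact: cvg_cst.
under eq_fun do rewrite big_cons; rewrite big_cons; case: (P i) => //.
apply: cvgM => //; apply: cvgB; last exact: cvg_cst.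
by rewrite -[X in (_ --> X)%classic]addr0; apply: cvgD => //; exact: cvg_cst.
Qed.

(** One difference quotient computed in two ways identifies [dmu F] at the root with the product of
    the differences between [dr i0] and the other roots. *)
Lemma simple_root_dmu (F : texp R d) n (dr : 'I_n -> R) i0 :
  (forall mu, teval F mu 0 = \prod_i (mu - dr i)) ->
  (forall i, i != i0 -> dr i != dr i0) -> teval (dmu F) (dr i0) 0 != 0.
Proof.
move=> FE simp.
have slope1 : (h^-1 * (dr i0 + h - dr i0) @[h --> (0:R)^'] --> (1:R))%classic.
  apply: (@cvg_neq0_eq _ _ (fun=> 1)) => [h h0|]; last exact: cvg_cst.
  by field.
(* Moving [th] in direction 0 leaves only the [mu] part of the slope. *)
have := @texp_deriv R d F _ _ _ 0 0 slope1.
rewrite mul1r [teval (dth _ _) _ _]dth_basis big1 => [|i _]; last by rewrite mxE mul0r.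
rewrite addr0 => L1.
have L2 := @prod_cvg _ (index_enum 'I_n) (fun i => i != i0) dr (dr i0).
have -> : teval (dmu F) (dr i0) 0 = \prod_(i | i != i0) (dr i0 - dr i).
  apply: (cvg_unique _ L1); first exact: norm_hausdorff.
  apply: cvg_neq0_eq L2 => h h0.
  rewrite scaler0 addr0 !FE (bigD1 i0) //= [X in _ - X](bigD1 i0) //= subrr mul0r subr0.
  by rewrite [dr i0 + h]addrC addrK mulKf.
by apply/prodf_neq0 => i ii0; rewrite subr_eq0 eq_sym simp.
Qed.

End CharPolyTexp.

(** * Periodic graphs and the ground state transform *)

Section ComplexParts.
Variable R : realType.
Implicit Types (z w : R[i]) (a b : R).

Lemma Re_sum (I : Type) (r : seq I) (P : pred I) (F : I -> R[i]) :
  complex.Re (\sum_(i <- r | P i) F i) = \sum_(i <- r | P i) complex.Re (F i).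
Proof. by apply: (big_morph (@complex.Re R)) => // -[a b] [c e]. Qed.

Lemma ReB z w : complex.Re (z - w) = complex.Re z - complex.Re w.
Proof. by case: z w => a b [c e]. Qed.

Lemma ReM_real z a : complex.Re (z * a%:C) = complex.Re z * a.
Proof. by case: z => x y /=; rewrite mulr0 subr0. Qed.

Lemma normsqM_real a z : normsq (a%:C * z) = a ^+ 2 * normsq z.
Proof. by case: z => x y; rewrite /normsq /=; ring. Qed.

Lemma normsq_real a : normsq a%:C = a ^+ 2.
Proof. by rewrite /normsq /=; ring. Qed.

Lemma conjC_real a : Num.conj a%:C = a%:C.
Proof. by rewrite conjCE conjc_real. Qed.

Lemma normsq_expi a : normsq (expi a) = 1.
Proof. by rewrite /normsq /= cos2Dsin2. Qed.

Lemma expi0 : expi (0 : R) = 1.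
Proof. by rewrite /expi cos0 sin0. Qed.

Lemma expiD a b : expi (a + b) = expi a * expi b.
Proof. by rewrite /expi cosD sinD; simpc; congr Complex; ring. Qed.

Lemma expiN a : expi (- a) = Num.conj (expi a).
Proof. by rewrite /expi cosN sinN. Qed.

Lemma norm_expi a : `|expi a| = 1.
Proof.
apply/eqP; rewrite -sqrp_eq1 ?normr_ge0 // -add_Re2_Im2 -[X in X%:C]/(normsq (expi a)).
by rewrite normsq_expi.
Qed.

Lemma normsq_sub z w c : normsq c = 1 ->
  normsq (z * c - w) = normsq z + normsq w - 2 * complex.Re (z * c * Num.conj w).
Proof.
rewrite conjCE; case: z w c => a b [x y] [c e]; rewrite /normsq /= => E.
have -> : (a * c - b * e - x) ^+ 2 + (a * e + b * c - y) ^+ 2 =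
  (a ^+ 2 + b ^+ 2) * (c ^+ 2 + e ^+ 2) + (x ^+ 2 + y ^+ 2)
   - 2 * ((a * c - b * e) * x - (a * e + b * c) * (- y)) by ring.
by rewrite E mulr1.
Qed.

(** [c] enters through its real and imaginary parts separately, to match increments of cosine and
    sine; products of the parts of [z] and [w] are bounded by means of squares. *)
Lemma Re_triple_le z w c : `|complex.Re (z * c * Num.conj w)| <=
  (`|complex.Re c| + `|complex.Im c|) * ((normsq z + normsq w) / 2).
Proof.
rewrite conjCE; case: z w c => a b [x y] [c e]; rewrite /normsq /=.
have -> : (a * c - b * e) * x - (a * e + b * c) * (- y) =
   c * (a * x + b * y) + e * (a * y - b * x) by ring.
set S := (_ / 2).
have S1 : `|a * x + b * y| <= S.
  rewrite ler_norml /S; apply/andP; split.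
    have := sqr_ge0 (a + x); have := sqr_ge0 (b + y); nra.
  have := sqr_ge0 (a - x); have := sqr_ge0 (b - y); nra.
have S2 : `|a * y - b * x| <= S.
  rewrite ler_norml /S; apply/andP; split.
    have := sqr_ge0 (a + y); have := sqr_ge0 (b - x); nra.
  have := sqr_ge0 (a - y); have := sqr_ge0 (b + x); nra.
apply: le_trans (ler_normD _ _) _; rewrite !normrM mulrDl.
by apply: lerD; apply: ler_wpM2l.
Qed.

Lemma Re_mul_conj_le z w :
  complex.Re (z * Num.conj w) <= Num.sqrt (normsq z) * Num.sqrt (normsq w).
Proof.
rewrite -sqrtrM ?normsq_ge0 //; apply: le_trans (ler_norm _) _.
rewrite -sqrtr_sqr ler_wsqrtr // conjCE; case: z w => a b [x y]; rewrite /normsq /=.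
have -> : (a ^+ 2 + b ^+ 2) * (x ^+ 2 + y ^+ 2) =
  (a * x - b * - y) ^+ 2 + (a * y - b * x) ^+ 2 by ring.
by rewrite lerDl sqr_ge0.
Qed.

End ComplexParts.

(** * Fibre operators of a periodic graph *)

Section Graph.
Variables (R : realType) (d nu : nat) (G : pgraph d nu).
Hypothesis nu_gt0 : (0 < nu)%N.
Hypothesis wfG : wf_pgraph G.
Hypothesis connG : lift_connected G.
Hypothesis deg_gt0 : forall v, (0 < deg G v)%N.
Local Notation s := (src G).
Local Notation t := (tgt G).

Definition amp (e : arc G) : R := (Num.sqrt ((deg G (s e))%:R * (deg G (t e))%:R))^-1.

Lemma amp_gt0 e : 0 < amp e.
Proof. by rewrite invr_gt0 sqrtr_gt0 mulr_gt0 // ltr0n. Qed.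

Lemma rev_inj : injective (rev G).
Proof. by move=> e f E; have [<- _ _ _ _] := wfG e; rewrite E; case: (wfG f). Qed.

Lemma amp_rev e : amp (rev G e) = amp e.
Proof. by rewrite /amp; case: (wfG e) => _ _ -> -> _; rewrite mulrC. Qed.

Lemma ipzN (m : 'rV[int]_d) (th : 'rV[R]_d) : ipz (- m) th = - ipz m th.
Proof.
by rewrite /ipz -sumrN; apply: eq_bigr => i _; rewrite mxE mulrNz mulNr.
Qed.

Lemma ipzD (m m' : 'rV[int]_d) (th : 'rV[R]_d) : ipz (m + m') th = ipz m th + ipz m' th.
Proof.
by rewrite /ipz -big_split; apply: eq_bigr => i _ /=; rewrite mxE intrD mulrDl.
Qed.

Lemma sum_arcs_rev (F : arc G -> R) : \sum_e F (rev G e) = \sum_e F e.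
Proof. by rewrite [RHS](reindex_inj rev_inj). Qed.

Lemma fiberH_amp (Q : 'I_nu -> R) th v w : fiberH G Q th v w =
  (if v == w then 1 + Q v else 0)%:C -
  \sum_(e : arc G | (s e == v) && (t e == w)) expi (ipz (tau G e) th) * (amp e)%:C.
Proof.
rewrite mxE; congr (_ - _); apply: eq_bigr => e /andP[/eqP <- /eqP <-].
by rewrite /amp fmorphV.
Qed.

(** Arc reversal exchanges the ends, keeps [amp] and negates [tau], hence conjugates the phase. *)
Lemma fiberH_herm (Q : 'I_nu -> R) th v w :
  fiberH G Q th w v = Num.conj (fiberH G Q th v w).
Proof.
rewrite !fiberH_amp rmorphB rmorph_sum /=; congr (_ - _).
  by rewrite eq_sym conjC_real; case: eqP => // ->.
rewrite (reindex_inj rev_inj) /=; apply: eq_big => e.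
  by case: (wfG e) => _ _ -> -> _; rewrite andbC.
move=> _; rewrite amp_rev rmorphM /= conjC_real -expiN -ipzN.
by case: (wfG e) => _ _ _ _ ->.
Qed.

Lemma sum_arcs_ends (V : nmodType) (F : 'I_nu -> 'I_nu -> arc G -> V) :
  \sum_v \sum_w \sum_(e | (s e == v) && (t e == w)) F v w e = \sum_e F (s e) (t e) e.
Proof.
rewrite pair_big /= [RHS](partition_big (fun e => (s e, t e)) xpredT) //=.
apply: eq_bigr => -[v w] _ /=; apply: eq_big => [e|e /andP[/eqP -> /eqP ->] //].
by rewrite xpair_eqE.
Qed.

Lemma sum_arcs_src (V : nmodType) (F : 'I_nu -> arc G -> V) :
  \sum_v \sum_(e | s e == v) F v e = \sum_e F (s e) e.
Proof.
rewrite [RHS](partition_big s xpredT) //=.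
by apply: eq_bigr => v _; apply: eq_bigr => e /eqP ->.
Qed.

Lemma hform_fiber (Q : 'I_nu -> R) th (u : 'rV[R[i]]_nu) :
  hform (fiberH G Q th) u = \sum_v (1 + Q v) * normsq (u 0 v) -
    \sum_e amp e * complex.Re (u 0 (s e) * expi (ipz (tau G e) th) * Num.conj (u 0 (t e))).
Proof.
rewrite /hform.
transitivity (complex.Re (\sum_v ((1 + Q v) * normsq (u 0 v))%:C -
   \sum_e (u 0 (s e) * expi (ipz (tau G e) th) * Num.conj (u 0 (t e))) * (amp e)%:C)); last first.
  rewrite ReB !Re_sum; congr (_ - _).
  by apply: eq_bigr => e _; rewrite ReM_real mulrC.
congr complex.Re.
rewrite -(sum_arcs_ends (fun v w e => u 0 v * expi (ipz (tau G e) th) * Num.conj (u 0 w) * (amp e)%:C)).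
rewrite -sumrB; apply: eq_bigr => v _.
transitivity (\sum_w (u 0 v * (if v == w then 1 + Q v else 0)%:C * Num.conj (u 0 w) -
  \sum_(e | (s e == v) && (t e == w)) u 0 v * expi (ipz (tau G e) th) * Num.conj (u 0 w) * (amp e)%:C)).
  apply: eq_bigr => w _; rewrite fiberH_amp mulrBr mulrBl; congr (_ - _).
  by rewrite mulr_sumr mulr_suml; apply: eq_bigr => e _; ring.
rewrite sumrB; congr (_ - _); rewrite (bigD1 v) //= eqxx big1 ?addr0 => [|w wv].
  by rewrite mulrAC normsqE -rmorphM mulrC.
by rewrite eq_sym (negbTE wv) mulr0 mul0r.
Qed.

(** The action of H(0) on real functions: at [th = 0] every phase is 1. *)
Definition opr (Q psi : 'I_nu -> R) (v : 'I_nu) : R :=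
  (1 + Q v) * psi v - \sum_(e | s e == v) amp e * psi (t e).

Lemma fiberH_colC Q psi : fiberH G Q 0 *m colC psi = colC (opr Q psi).
Proof.
apply/matrixP => v z; rewrite !mxE.
transitivity (\sum_w (if v == w then 1 + Q v else 0)%:C * (psi w)%:C -
   \sum_w \sum_(e | (s e == v) && (t e == w)) (amp e * psi w)%:C).
  rewrite -sumrB; apply: eq_bigr => w _; rewrite fiberH_amp [colC _ _ _]mxE mulrBl; congr (_ - _).
  by rewrite mulr_suml; apply: eq_bigr => e _; rewrite ipz0 expi0 mul1r rmorphM.
rewrite rmorphB rmorphM /=; congr (_ - _).
  rewrite (bigD1 v) //= eqxx big1 ?addr0 // => w wv.
  by rewrite eq_sym (negbTE wv) mul0r.
rewrite rmorph_sum /= [RHS](partition_big t xpredT) //=.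
by apply: eq_bigr => w _; apply: eq_bigr => e /andP[_ /eqP ->].
Qed.

(** Conjugating the row equation turns a real left eigenvector into a right one, by
    [fiberH_herm]. *)
Lemma row_mul_fiberH Q psi th (u : 'rV[R[i]]_nu) lam :
  (forall v, u 0 v = (psi v)%:C) -> u *m fiberH G Q th = lam%:C *: u ->
  fiberH G Q th *m colC psi = lam%:C *: colC psi.
Proof.
move=> uE E; apply/matrixP => v z; have /rowP/(_ v) := E; rewrite !mxE uE.
move/(congr1 Num.conj); rewrite rmorph_sum rmorphM /= !conjC_real => <-.
apply: eq_bigr => w _.
by rewrite uE rmorphM /= -fiberH_herm conjC_real [colC _ _ _]mxE mulrC.
Qed.

(** The eigenvalue equation for [psi] trades the diagonal term for a sum over arcs, which completes
    the cross terms to squares. *)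
Lemma ground_identity (Q psi : 'I_nu -> R) lam th (g : 'I_nu -> R[i]) (u : 'rV[R[i]]_nu) :
  (forall v, opr Q psi v = lam * psi v) -> (forall v, u 0 v = (psi v)%:C * g v) ->
  hform (fiberH G Q th) u = lam * (\sum_v normsq (u 0 v)) +
    2^-1 * \sum_e amp e * psi (s e) * psi (t e) *
       normsq (g (s e) * expi (ipz (tau G e) th) - g (t e)).
Proof.
move=> eig uE; rewrite hform_fiber.
pose W e := amp e * psi (s e) * psi (t e).
have E1 : \sum_v (1 + Q v) * normsq (u 0 v) =
    lam * (\sum_v normsq (u 0 v)) + \sum_e W e * normsq (g (s e)).
  rewrite -(sum_arcs_src (fun v e => amp e * psi v * psi (t e) * normsq (g v))).
  rewrite mulr_sumr -big_split; apply: eq_bigr => v _ /=; rewrite uE normsqM_real.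
  have -> : \sum_(e | s e == v) amp e * psi v * psi (t e) * normsq (g v) =
     psi v * normsq (g v) * \sum_(e | s e == v) amp e * psi (t e).
    by rewrite mulr_sumr; apply: eq_bigr => e _; ring.
  have := eig v; rewrite /opr => /eqP; rewrite subr_eq => /eqP E.
  transitivity (psi v * normsq (g v) * ((1 + Q v) * psi v)); first by ring.
  by rewrite E; ring.
(* Reversal swaps sources and targets, so both square terms contribute equally; this accounts for
   the factor 1/2. *)
have E2 : \sum_e W e * normsq (g (t e)) = \sum_e W e * normsq (g (s e)).
  rewrite -sum_arcs_rev; apply: eq_bigr => e _; rewrite /W amp_rev.
  by case: (wfG e) => _ _ -> -> _; ring.
have E3 e : amp e * complex.Re (u 0 (s e) * expi (ipz (tau G e) th) * Num.conj (u 0 (t e))) =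
   W e * complex.Re (g (s e) * expi (ipz (tau G e) th) * Num.conj (g (t e))).
  rewrite !uE rmorphM /= conjC_real.
  transitivity (amp e * complex.Re ((g (s e) * expi (ipz (tau G e) th) * Num.conj (g (t e)))
     * (psi (s e) * psi (t e))%:C)).
    by rewrite rmorphM /=; congr (_ * complex.Re _); ring.
  by rewrite ReM_real /W; ring.
under [X in _ - X]eq_bigr do rewrite E3.
have -> : \sum_e amp e * psi (s e) * psi (t e) *
    normsq (g (s e) * expi (ipz (tau G e) th) - g (t e)) =
  \sum_e W e * normsq (g (s e)) + \sum_e W e * normsq (g (t e)) -
  2 * \sum_e W e * complex.Re (g (s e) * expi (ipz (tau G e) th) * Num.conj (g (t e))).
  rewrite mulr_sumr -big_split -sumrB; apply: eq_bigr => e _ /=.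
  by rewrite normsq_sub ?normsq_expi // /W; ring.
by rewrite E2 E1; field.
Qed.

Lemma sum_normsq_gt0 (u : 'rV[R[i]]_nu) : u != 0 -> 0 < \sum_v normsq (u 0 v).
Proof.
case/rV0Pn => v uv; rewrite (bigD1 v) //= ltr_pwDl //.
  by rewrite lt_def normsq_eq0 uv normsq_ge0.
by apply: sumr_ge0 => w _; exact: normsq_ge0.
Qed.

Lemma hform_eigen (A : 'M[R[i]]_nu) (u : 'rV[R[i]]_nu) (lam : R) :
  u *m A = lam%:C *: u -> hform A u = lam * \sum_v normsq (u 0 v).
Proof.
move=> E; rewrite hformE E -scalemxAl mxE.
have -> : (u *m u^t* ) 0 0 = (\sum_v normsq (u 0 v))%:C.
  by rewrite mxE rmorph_sum; apply: eq_bigr => i _; rewrite /= -normsqE !mxE.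
by rewrite -rmorphM.
Qed.

(** The lowest eigenvector of [A] is a trial vector for [B]. *)
Lemma lmin_perturb (A B : 'M[R[i]]_nu) (c : R) :
  (forall i j, A j i = Num.conj (A i j)) -> (forall i j, B j i = Num.conj (B i j)) ->
  (forall u, hform B u <= hform A u + c * \sum_v normsq (u 0 v)) -> lmin B <= lmin A + c.
Proof.
move=> hA hB AB; have [u u0 uE] := lmin_eigenvector nu_gt0 hA.
have := le_trans (lmin_le_hform nu_gt0 hB u) (AB u).
by rewrite (hform_eigen uE) -mulrDl (ler_pM2r (sum_normsq_gt0 u0)).
Qed.

(** * Consequences of a positive ground state *)

Section GroundState.
Variables (Q psi : 'I_nu -> R) (lam : R).
Hypothesis psi_gt0 : forall v, 0 < psi v.
Hypothesis psi_eig : forall v, opr Q psi v = lam * psi v.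

Let psiK (u : 'rV[R[i]]_nu) v : u 0 v = (psi v)%:C * ((psi v)^-1%:C * u 0 v).
Proof. by rewrite mulrA -rmorphM divff ?gt_eqF //= mul1r. Qed.

Lemma energy_term_ge0 th (g : 'I_nu -> R[i]) e :
  0 <= amp e * psi (s e) * psi (t e) * normsq (g (s e) * expi (ipz (tau G e) th) - g (t e)).
Proof.
by rewrite !mulr_ge0 ?normsq_ge0 // ?ltW ?amp_gt0 ?psi_gt0.
Qed.

Lemma ground_le th : lam <= lmin (fiberH G Q th).
Proof.
have [u u0 uE] := lmin_eigenvector nu_gt0 (fiberH_herm Q th).
have := hform_eigen uE; rewrite (ground_identity th psi_eig (psiK u)) => E.
rewrite -(ler_pM2r (sum_normsq_gt0 u0)) -E lerDl mulr_ge0 ?invr_ge0 ?ler0n //.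
by apply: sumr_ge0 => e _; exact: (energy_term_ge0 th (fun v => (psi v)^-1%:C * u 0 v)).
Qed.

(** For [u = psi], that is [g = 1], every energy term vanishes at [th = 0]: a positive eigenvector
    always belongs to the lowest eigenvalue. *)
Lemma ground_lmin0 : lmin (fiberH G Q 0) = lam.
Proof.
apply/eqP; rewrite eq_le ground_le andbT.
pose u : 'rV[R[i]]_nu := \row_v (psi v)%:C.
have uE v : u 0 v = (psi v)%:C * 1 by rewrite mxE mulr1.
have u0 : u != 0.
  apply/rV0Pn; exists (Ordinal nu_gt0); rewrite uE mulr1.
  by rewrite -[0]/((0 : R)%:C) (inj_eq (@complexI R)) gt_eqF.
have := lmin_le_hform nu_gt0 (fiberH_herm Q 0) u.
rewrite (ground_identity (g := fun=> 1) 0 psi_eig uE).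
rewrite [X in 2^-1 * X]big1 => [|e _]; first by rewrite mulr0 addr0 (ler_pM2r (sum_normsq_gt0 u0)).
by rewrite ipz0 expi0 mulr1 subrr /normsq /= expr0n /= addr0 mulr0.
Qed.

Lemma reach_const (g : 'I_nu -> R[i]) x y :
  (forall e : arc G, g (s e) = g (t e)) -> reach (@lift_adj d nu G) x y -> g x.1 = g y.1.
Proof. by move=> ge; elim=> // {}x {}y z [e [<- <- _]] _ <-. Qed.

(** Zero energy forces [u / psi] to agree at the two ends of each arc, hence by connectedness to be
    constant. *)
Lemma ground_simple (u w : 'rV[R[i]]_nu) :
  u *m fiberH G Q 0 = lam%:C *: u -> w *m fiberH G Q 0 = lam%:C *: w ->
  u != 0 -> exists a, w = a *: u.
Proof.
have cst (f : 'rV[R[i]]_nu) : f *m fiberH G Q 0 = lam%:C *: f ->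
    exists c, forall v, f 0 v = (psi v)%:C * c.
  move=> fE; have := hform_eigen fE; rewrite (ground_identity 0 psi_eig (psiK f)).
  rewrite -[RHS]addr0 => /addrI /eqP; rewrite mulf_eq0 invr_eq0 pnatr_eq0 /= => /eqP S0.
  have ge (e : arc G) : (psi (s e))^-1%:C * f 0 (s e) = (psi (t e))^-1%:C * f 0 (t e).
    have /eqP := psumr_eq0P (fun e _ => energy_term_ge0 0 (fun v => (psi v)^-1%:C * f 0 v) e) S0 (erefl : xpredT e).
    rewrite mulf_eq0 gt_eqF /=; last by rewrite !mulr_gt0 ?amp_gt0.
    by rewrite normsq_eq0 ipz0 expi0 mulr1 subr_eq0 => /eqP.
  exists ((psi (Ordinal nu_gt0))^-1%:C * f 0 (Ordinal nu_gt0)) => v; rewrite {1}psiK; congr (_ * _).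
  exact: (@reach_const (fun v => (psi v)^-1%:C * f 0 v) _ _ ge (connG (v, 0) (Ordinal nu_gt0, 0))).
move=> /cst[a uE] /cst[b wE] u0.
have a0 : a != 0.
  apply: contraNneq u0 => a0; apply/eqP/rowP => v; rewrite uE a0 mulr0 mxE //.
exists (b / a); apply/rowP => v; rewrite mxE uE wE mulrCA divfK //.
Qed.

End GroundState.

(** With [u = psi2 * g] optimal for the second operator, [psi1 * g] is a trial vector for the first:
    its energy is at most [b ^+ 2] times, its squared norm at least [a ^+ 2] times, that of [u]. *)
Lemma ground_compare (Q1 psi1 Q2 psi2 : 'I_nu -> R) lam1 lam2 a b th :
  (forall v, 0 < psi1 v) -> (forall v, opr Q1 psi1 v = lam1 * psi1 v) ->
  (forall v, 0 < psi2 v) -> (forall v, opr Q2 psi2 v = lam2 * psi2 v) ->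
  0 < a -> (forall v, a * psi2 v <= psi1 v <= b * psi2 v) ->
  lmin (fiberH G Q1 th) - lam1 <= (b / a) ^+ 2 * (lmin (fiberH G Q2 th) - lam2).
Proof.
move=> p1 e1 p2 e2 a0 ab.
have [u u0 uE] := lmin_eigenvector nu_gt0 (fiberH_herm Q2 th).
pose g v := (psi2 v)^-1%:C * u 0 v.
have ug v : u 0 v = (psi2 v)%:C * g v.
  by rewrite /g mulrA -rmorphM divff ?gt_eqF //= mul1r.
pose w : 'rV[R[i]]_nu := \row_v ((psi1 v)%:C * g v).
have wg v : w 0 v = (psi1 v)%:C * g v by rewrite mxE.
have := hform_eigen uE; rewrite (ground_identity th e2 ug); set E2 := (X in _ + X) => EE2.
have := lmin_le_hform nu_gt0 (fiberH_herm Q1 th) w.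
rewrite (ground_identity th e1 wg); set E1 := (X in _ + X) => EE1.
have b0 : 0 < b.
  have /andP[l r] := ab (Ordinal nu_gt0); have := le_trans l r.
  by rewrite ler_pM2r // => /(lt_le_trans a0).
have E12 : E1 <= b ^+ 2 * E2.
  rewrite /E1 /E2 mulrCA ler_wpM2l ?invr_ge0 ?ler0n // mulr_sumr ler_sum // => e _.
  have /andP[_ le1] := ab (s e); have /andP[_ le2] := ab (t e).
  rewrite mulrA ler_wpM2r ?normsq_ge0 //.
  have -> : b ^+ 2 * (amp e * psi2 (s e) * psi2 (t e)) =
    amp e * ((b * psi2 (s e)) * (b * psi2 (t e))) by ring.
  by rewrite -mulrA ler_wpM2l ?ler_pM // ltW ?amp_gt0.
have n12 : a ^+ 2 * \sum_v normsq (u 0 v) <= \sum_v normsq (w 0 v).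
  rewrite mulr_sumr ler_sum // => v _; rewrite wg ug (normsqM_real (psi1 v)) (normsqM_real (psi2 v)) mulrA.
  have /andP[av _] := ab v.
  rewrite ler_wpM2r ?normsq_ge0 // -exprMn; apply: lerXn2r => //.
    by rewrite nnegrE mulr_ge0 // ltW.
  by rewrite nnegrE ltW.
(* Replacing the squared norm by its lower bound needs this factor to be nonnegative. *)
have l0 := ground_le p1 e1 th; rewrite -subr_ge0 in l0.
have n0 := sum_normsq_gt0 u0.
move: n0 EE1 EE2 E12 n12; set n2 := \sum_v normsq (u 0 v); set n1 := \sum_v normsq (w 0 v).
move: l0; set l1 := lmin _; set l2 := lmin _ => l0 n0 EE1 EE2 E12 n12.
have E2E : E2 = (l2 - lam2) * n2 by rewrite mulrBl -EE2 addrAC subrr add0r.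
have E1E : (l1 - lam1) * n1 <= E1 by rewrite mulrBl lerBlDl.
rewrite expr_div_n mulrAC ler_pdivlMr ?exprn_gt0 // -(ler_pM2r n0).
rewrite -(mulrA (l1 - lam1)) -(mulrA (b ^+ 2)) -E2E.
by apply: le_trans _ E12; apply: le_trans _ E1E; exact: ler_wpM2l.
Qed.

(* The entrywise modulus of a lowest eigenvector is again one; a zero of it would
   spread to all neighbours. *)
Lemma perron (Q : 'I_nu -> R) : exists psi : 'I_nu -> R,
  (forall v, 0 < psi v) /\ (forall v, opr Q psi v = lmin (fiberH G Q 0) * psi v).
Proof.
have [u u0 uE] := lmin_eigenvector nu_gt0 (fiberH_herm Q 0).
pose psi v := Num.sqrt (normsq (u 0 v)).
pose w : 'rV[R[i]]_nu := \row_v (psi v)%:C.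
have wE v : w 0 v = (psi v)%:C by rewrite mxE.
have nE v : normsq (w 0 v) = normsq (u 0 v).
  by rewrite wE normsq_real sqr_sqrtr // normsq_ge0.
have le_wu : hform (fiberH G Q 0) w <= hform (fiberH G Q 0) u.
  rewrite !hform_fiber; apply: lerB; first by under eq_bigr do rewrite nE.
  apply: ler_sum => e _; apply: ler_wpM2l; first by rewrite ltW ?amp_gt0.
  rewrite ipz0 expi0 !mulr1 !wE.
  rewrite conjC_real -rmorphM -[X in _ <= X]/(psi (s e) * psi (t e)).
  exact: Re_mul_conj_le.
have wH : w *m fiberH G Q 0 = (lmin (fiberH G Q 0))%:C *: w.
  apply: (lmin_hform_eq nu_gt0 (fiberH_herm Q 0)); apply/eqP.
  rewrite eq_le (lmin_le_hform nu_gt0 (fiberH_herm Q 0)) andbT.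
  by under eq_bigr do rewrite nE; rewrite -(hform_eigen uE).
have psiE v : opr Q psi v = lmin (fiberH G Q 0) * psi v.
  have := row_mul_fiberH wE wH; rewrite fiberH_colC => /matrixP/(_ v 0).
  by rewrite !mxE -rmorphM => /complexI.
exists psi; split => // v.
have psi_ge0 x : 0 <= psi x by exact: sqrtr_ge0.
rewrite lt_def psi_ge0 andbT; apply/eqP => pv0.
have spread x y : reach (@lift_adj d nu G) x y -> psi x.1 = 0 -> psi y.1 = 0.
  elim=> // {}x {}y z [e [se te _]] _ IH px; apply: IH.
  have := psiE x.1; rewrite /opr px !mulr0 sub0r => /eqP; rewrite oppr_eq0 => /eqP S0.
  have nn e' : s e' == x.1 -> 0 <= amp e' * psi (t e').
    by move=> _; rewrite mulr_ge0 // ltW // amp_gt0.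
  have /eqP := psumr_eq0P nn S0 (introT eqP se).
  by rewrite mulf_eq0 gt_eqF ?amp_gt0 //= te => /eqP.
case/negP: u0; apply/eqP/rowP => x; rewrite mxE; apply/eqP; rewrite -normsq_eq0.
have := spread _ _ (connG (v, 0) (x, 0)) pv0; rewrite /= /psi => /eqP.
by rewrite sqrtr_eq0 le_eqVlt ltNge normsq_ge0 orbF.
Qed.

Lemma ipz0l (th : 'rV[R]_d) : ipz 0 th = 0.
Proof. by rewrite /ipz big1 // => i _; rewrite mxE mul0r. Qed.

(** Telescoping along the walk: [N] is its length, and the phases picked up on the way have modulus
    1. It is chosen before [th] and [g], so the bound is uniform. *)
Lemma walk_bound x y : reach (@lift_adj d nu G) x y ->
  exists N : nat, forall (th : 'rV[R]_d) (g : 'I_nu -> R[i]) (D : R[i]),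
    (forall e, `|g (s e) * expi (ipz (tau G e) th) - g (t e)| <= D) ->
    `|g x.1 * expi (ipz (y.2 - x.2) th) - g y.1| <= N%:R * D.
Proof.
elim=> [{}x|{}x {}y z [e [se te ye]] _ [N IH]].
  by exists 0%N => th g D _; rewrite subrr ipz0l expi0 mulr1 subrr normr0 mul0r.
exists N.+1 => th g D gD.
have -> : g x.1 * expi (ipz (z.2 - x.2) th) - g z.1 =
    (g (s e) * expi (ipz (tau G e) th) - g (t e)) * expi (ipz (z.2 - y.2) th)
    + (g y.1 * expi (ipz (z.2 - y.2) th) - g z.1).
  have -> : z.2 - x.2 = tau G e + (z.2 - y.2).
    by rewrite ye opprD addrCA [tau G e + _]addrCA subrr addr0.
  by rewrite ipzD expiD se te; ring.
apply: le_trans (ler_normD _ _) _; rewrite normrM norm_expi mulr1.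
by rewrite -natr1 mulrDl mul1r addrC lerD // IH.
Qed.

Lemma normcE_sqrt (z : R[i]) : `|z| = (Num.sqrt (normsq z))%:C.
Proof. exact: normc_def. Qed.

Lemma normsq_mul_expi_sub (z : R[i]) a :
  normsq (z * expi a - z) = normsq z * (2 - 2 * cos a).
Proof.
rewrite normsq_sub ?normsq_expi //; case: z => x y.
by rewrite conjCE /normsq /=; ring.
Qed.

Lemma ipz_delta j (th : 'rV[R]_d) : ipz (delta_mx 0 j) th = th 0 j.
Proof.
rewrite /ipz (bigD1 j) //= big1 => [|i ij]; first by rewrite mxE !eqxx mul1r addr0.
by rewrite mxE (negbTE ij) andbF mul0r.
Qed.

(** The ground state of the Laplacian, with eigenvalue 0. *)
Definition sqrt_deg (v : 'I_nu) : R := Num.sqrt (deg G v)%:R.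

Lemma sqrt_deg_gt0 v : 0 < sqrt_deg v.
Proof. by rewrite sqrtr_gt0 ltr0n. Qed.

Lemma ampE e : amp e = (sqrt_deg (s e) * sqrt_deg (t e))^-1.
Proof. by rewrite /amp /sqrt_deg sqrtrM // ler0n. Qed.

(** Each of the [deg G v] arcs leaving [v] contributes the reciprocal of [sqrt_deg v], which adds up
    to [sqrt_deg v]. *)
Lemma sqrt_deg_eig v : opr (fun=> 0) sqrt_deg v = 0 * sqrt_deg v.
Proof.
rewrite /opr addr0 mul1r mul0r.
rewrite (eq_bigr (fun=> (sqrt_deg v)^-1)) => [|e /eqP <-]; last first.
  by rewrite ampE invfM -mulrA mulVf ?mulr1 // gt_eqF ?sqrt_deg_gt0.
rewrite sumr_const -[#|_|]/(deg G v) -mulr_natl.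
have -> : (deg G v)%:R = sqrt_deg v ^+ 2 by rewrite sqr_sqrtr // ler0n.
by rewrite expr2 mulfK ?subrr // gt_eqF // sqrt_deg_gt0.
Qed.

(** A walk from [(v, 0)] to [(v, delta_mx 0 j)] closes up in the quotient, so it compares [g v] with
    itself times the phase of [th 0 j]; the Laplacian energy controls the discrepancy. *)
Lemma laplace_lower j : exists2 K : R, 0 < K &
  forall th : 'rV[R]_d, 2 - 2 * cos (th 0 j) <= K * lmin (fiberH G (fun=> 0 : R) th).
Proof.
have aux (k x : R) : 0 <= x -> k * (2 * x) <= (2 * k + 1) * x by move=> ?; lra.
have [N NE] := fin_all_exists (fun v => walk_bound (connG (v, 0) (v, delta_mx 0 j))).
pose K0 := \sum_v sqrt_deg v ^+ 2 * (N v)%:R ^+ 2.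
have K00 : 0 <= K0 by apply: sumr_ge0 => v _; rewrite mulr_ge0 ?sqr_ge0.
(* The factor 2 undoes the 1/2 in the energy identity; the added 1 makes the constant strictly
   positive. *)
exists (2 * K0 + 1) => [|th]; first by rewrite ltr_wpDl // mulr_ge0.
have [u u0 uE] := lmin_eigenvector nu_gt0 (fiberH_herm (fun=> 0) th).
pose g v := (sqrt_deg v)^-1%:C * u 0 v.
have ug v : u 0 v = (sqrt_deg v)%:C * g v.
  by rewrite /g mulrA -rmorphM divff ?gt_eqF ?sqrt_deg_gt0 //= mul1r.
pose S := \sum_e normsq (g (s e) * expi (ipz (tau G e) th) - g (t e)).
have S0 : 0 <= S by apply: sumr_ge0 => e _; exact: normsq_ge0.
have := hform_eigen uE; rewrite (ground_identity th sqrt_deg_eig ug) mul0r add0r.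
(* All edge weights become 1, because [amp] cancels the two values of [sqrt_deg]. *)
rewrite (eq_bigr (fun e => normsq (g (s e) * expi (ipz (tau G e) th) - g (t e)))) => [|e _]; last first.
  by rewrite ampE -[_ * sqrt_deg (t e)]mulrA mulVf ?mul1r // mulf_neq0 // gt_eqF ?sqrt_deg_gt0.
rewrite -/S => SE.
have gD e : `|g (s e) * expi (ipz (tau G e) th) - g (t e)| <= (Num.sqrt S)%:C.
  rewrite normcE_sqrt lecR ler_wsqrtr // /S (bigD1 e) //= lerDl.
  by apply: sumr_ge0 => e' _; exact: normsq_ge0.
have gN v : normsq (g v) * (2 - 2 * cos (th 0 j)) <= (N v)%:R ^+ 2 * S.
  have := NE v th g _ gD; rewrite /= subr0 ipz_delta normcE_sqrt normsq_mul_expi_sub.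
  rewrite -[(N v)%:R](rmorph_nat (real_complex R)) -rmorphM lecR => le1.
  have X0 : 0 <= normsq (g v) * (2 - 2 * cos (th 0 j)).
    by rewrite -normsq_mul_expi_sub normsq_ge0.
  apply: (@le_trans _ _ (((N v)%:R * Num.sqrt S) ^+ 2)); last by rewrite exprMn sqr_sqrtr.
  rewrite -[X in X <= _]sqr_sqrtr //.
  by apply: lerXn2r => //; rewrite nnegrE ?mulr_ge0 ?sqrtr_ge0.
have n0 := sum_normsq_gt0 u0.
have l0 := ground_le sqrt_deg_gt0 sqrt_deg_eig th.
rewrite -(ler_pM2r n0); apply: (@le_trans _ _ (K0 * S)).
  rewrite mulr_sumr /K0 mulr_suml; apply: ler_sum => v _.
  rewrite ug (normsqM_real (sqrt_deg v)) mulrCA -mulrA ler_wpM2l ?sqr_ge0 // mulrC.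
  exact: gN.
move: SE n0 l0; set l := lmin _; set n := \sum_v _ => SE n0 l0.
have -> : S = 2 * (l * n) by rewrite -SE; field.
by rewrite -mulrA; apply: aux; exact: mulr_ge0 l0 (ltW n0).
Qed.

(** Bounds the norm of the difference of the fibre operators at [th] and [th'], whatever the
    potential. *)
Definition osc (th th' : 'rV[R]_d) : R :=
  \sum_e amp e * (`|cos (ipz (tau G e) th') - cos (ipz (tau G e) th)| +
                  `|sin (ipz (tau G e) th') - sin (ipz (tau G e) th)|).

Lemma lmin_osc Q th th' : lmin (fiberH G Q th') <= lmin (fiberH G Q th) + osc th th'.
Proof.
apply: lmin_perturb (fiberH_herm Q th) (fiberH_herm Q th') _ => u.
rewrite (hform_fiber Q th') (hform_fiber Q th).
rewrite -addrA lerD2l -lerBlDl opprK addrC -sumrB.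
rewrite /osc mulr_suml; apply: ler_sum => e _; rewrite -mulrBr -(mulrA (amp e)).
apply: ler_wpM2l; first by rewrite ltW // amp_gt0.
rewrite -ReB -mulrBl -mulrBr.
apply: le_trans (ler_norm _) _; apply: le_trans (Re_triple_le _ _ _) _.
have -> : `|complex.Re (expi (ipz (tau G e) th) - expi (ipz (tau G e) th'))| =
  `|cos (ipz (tau G e) th') - cos (ipz (tau G e) th)| by rewrite /= distrC.
have -> : `|complex.Im (expi (ipz (tau G e) th) - expi (ipz (tau G e) th'))| =
  `|sin (ipz (tau G e) th') - sin (ipz (tau G e) th)| by rewrite /= distrC.
apply: ler_wpM2l; first by rewrite addr_ge0.
have le_n v : normsq (u 0 v) <= \sum_v normsq (u 0 v).
  by rewrite [X in _ <= X](bigD1 v) //= lerDl; apply: sumr_ge0 => w _; exact: normsq_ge0.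
by have := le_n (s e); have := le_n (t e); lra.
Qed.

Lemma osc_sym th th' : osc th th' = osc th' th.
Proof. by apply: eq_bigr => e _; rewrite distrC [X in _ + X]distrC. Qed.

(** A bound free of [th], from which the first band is bounded above. *)
Lemma osc_le th th' : osc th th' <= \sum_e amp e * 4.
Proof.
apply: ler_sum => e _; apply: ler_wpM2l; first by rewrite ltW // amp_gt0.
have le2 (x y : R) : `|x| <= 1 -> `|y| <= 1 -> `|x - y| <= 2.
  by move=> x1 y1; apply: le_trans (ler_normB _ _) (lerD x1 y1).
have -> : 4 = 2 + 2 :> R by ring.
by apply: lerD; apply: le2; rewrite ?cos_max ?sin_max.
Qed.

End Graph.

Lemma reach_first (T : Type) (r : T -> T -> Prop) x y :
  reach r x y -> x = y \/ exists z, r x z.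
Proof. by case=> [z|{}x z w rxz _]; [left|right; exists z]. Qed.

(** A walk from [(v, 0)] to a different translate of the same vertex must have a first step, which
    leaves [v]. *)
Lemma lift_connected_deg_gt0 d nu (G : pgraph d nu) : (0 < d)%N ->
  lift_connected G -> forall v, (0 < deg G v)%N.
Proof.
case: d G => // d G _ conn v.
have [[/rowP/(_ 0)]|[z [e [se _ _]]]] := reach_first (conn (v, 0) (v, delta_mx 0 0)).
  by rewrite !mxE.
by apply/card_gt0P; exists e; rewrite inE se.
Qed.

(** * The first band *)

Section BandComparison.
Variables (R : realType) (d : nat).

(** Both functions are minimal at 0, so each band length is a supremum of increments from 0 and the
    pointwise comparison passes to suprema. *)
Lemma band_compare (l l0 : 'rV[R]_d -> R) (k : R) (j : 'I_d) :
  0 < k -> l0 0 = 0 ->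
  (forall th, l th - l 0 <= k * l0 th) -> (forall th, l0 th <= k * (l th - l 0)) ->
  (exists2 K : R, 0 < K & forall th : 'rV[R]_d, 2 - 2 * cos (th 0 j) <= K * l0 th) ->
  has_ubound (range l0) ->
  (forall th, 0 <= l0 th) ->
  band_minus l < band_plus l /\ k^-1 * band_len l0 <= band_len l <= k * band_len l0.
Proof.
move=> k0 l00 c1 c2 [K K0 KE] [M Mub] l0pos.
have lmin_ th : l 0 <= l th by have := c2 th; have := l0pos th; nra.
have rne (f : 'rV[R]_d -> R) : (range f !=set0)%classic by exists (f 0); exists 0.
have bmE (f : 'rV[R]_d -> R) : (forall th, f 0 <= f th) -> band_minus f = f 0.
  move=> fm; apply/eqP; rewrite eq_le; apply/andP; split.
    by apply: ge_inf; [exists (f 0) => _ [th _ <-]|exists 0].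
  by apply: lb_le_inf => // _ [th _ <-].
have ub0 : has_ubound (range l0) by exists M.
have ub1 : has_ubound (range l).
  exists (l 0 + k * M) => _ [th _ <-]; rewrite -lerBlDl; apply: le_trans (c1 th) _.
  by rewrite ler_pM2l //; apply: Mub; exists th.
have le0 th : l0 th <= band_plus l0 by apply: ub_le_sup => //; exists th.
have le1 th : l th <= band_plus l by apply: ub_le_sup => //; exists th.
have s1 : band_plus l <= l 0 + k * band_plus l0.
  apply: ge_sup => // _ [th _ <-]; rewrite -lerBlDl; apply: le_trans (c1 th) _.
  by rewrite ler_pM2l.
have s0 : band_plus l0 <= k * (band_plus l - l 0).
  apply: ge_sup => // _ [th _ <-]; apply: le_trans (c2 th) _.
  by rewrite ler_pM2l // lerB.
have bm1 := bmE l lmin_.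
have bm0 : band_minus l0 = 0 by rewrite bmE // => th; rewrite l00.
rewrite /band_len bm0 bm1 subr0; split.
  (* With all coordinates equal to pi the left side is 4, so [l0] is positive there. *)
  have := KE (const_mx pi); rewrite mxE cospi => Kpi.
  have lp : 0 < l0 (const_mx pi).
    by rewrite -(pmulr_rgt0 _ K0); apply: lt_le_trans Kpi; lra.
  rewrite -subr_gt0 -(pmulr_rgt0 _ k0); apply: lt_le_trans s0.
  exact: lt_le_trans lp (le0 _).
by rewrite [k^-1 * _]mulrC ler_pdivrMr // [_ * k]mulrC s0 lerBlDl.
Qed.

Lemma effective_mass_compare (l l0 : 'rV[R]_d -> R) (k : R) :
  0 < k -> l0 0 = 0 ->
  (forall th, l th - l 0 <= k * l0 th) -> (forall th, l0 th <= k * (l th - l 0)) ->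
  (forall j : 'I_d, exists2 K : R, 0 < K &
     forall th : 'rV[R]_d, 2 - 2 * cos (th 0 j) <= K * l0 th) ->
  (hessian0 l)^T = hessian0 l -> (hessian0 l0)^T = hessian0 l0 ->
  (forall x, second_deriv0 (fun t => l (t *: x) - l 0) (qform (hessian0 l) x)) ->
  (forall x, second_deriv0 (fun t => l0 (t *: x) - l0 0) (qform (hessian0 l0) x)) ->
  [/\ hessian0 l \in unitmx, hessian0 l0 \in unitmx &
      forall x, k^-1 * qform (eff_mass l0) x <= qform (eff_mass l) x
                  <= k * qform (eff_mass l0) x].
Proof.
move=> k0 l00 c1 c2 lower sym sym0 sec sec0.
(* The difference of the two sides of [c1] along a line is nonnegative and vanishes at 0, so its
   second derivative there is nonnegative. *)
have q1 x : qform (hessian0 l) x <= k * qform (hessian0 l0) x.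
  rewrite -subr_ge0; apply: (second_deriv0_ge0 (second_deriv0_comb k (sec0 x) (sec x))).
    by rewrite !scale0r !subrr mulr0 subrr.
  by move=> t; rewrite l00 subr0 subr_ge0 c1.
have q0 x : qform (hessian0 l0) x <= k * qform (hessian0 l) x.
  rewrite -subr_ge0; apply: (second_deriv0_ge0 (second_deriv0_comb k (sec x) (sec0 x))).
    by rewrite !scale0r !subrr mulr0 subrr.
  by move=> t; rewrite l00 subr0 subr_ge0 c2.
(* The same argument with the minorant [2 - 2 * cos], in a coordinate where [x] is nonzero. *)
have pos0 x : x != 0 -> 0 < qform (hessian0 l0) x.
  case/rV0Pn => j xj; have [K K0 KE] := lower j.
  have := second_deriv0_ge0 (second_deriv0_comb K (sec0 x) (second_deriv0_cos (x 0 j) 1)).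
  rewrite !scale0r !subrr mulr0 mul1r mul0r cos0 mulr1 subrr subrr => /(_ erefl) H.
  have {}H : 0 <= K * qform (hessian0 l0) x - 2 * x 0 j ^+ 2.
    by rewrite -[X in _ - X]mul1r; apply: H => t; have := KE (t *: x); rewrite mxE l00 subr0 mul1r subr_ge0.
  rewrite -(pmulr_rgt0 _ K0); apply: (@lt_le_trans _ _ (2 * x 0 j ^+ 2)).
    by rewrite mulr_gt0 // lt_def sqr_ge0 sqrf_eq0 xj.
  by rewrite -subr_ge0.
have pos x : x != 0 -> 0 < qform (hessian0 l) x.
  by move=> /pos0 p; rewrite -(pmulr_rgt0 _ k0); exact: lt_le_trans p (q0 x).
have nonneg (A : 'M[R]_d) : (forall x, x != 0 -> 0 < qform A x) -> forall x, 0 <= qform A x.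
  move=> p x; have [->|/p/ltW //] := eqVneq x 0.
  by rewrite /qform !mul0mx mxE.
have u1 := qform_pos_unitmx pos; have u0 := qform_pos_unitmx pos0.
split => // x; rewrite /eff_mass [k^-1 * _]mulrC ler_pdivrMr // [_ * k]mulrC.
(* Inversion swaps the roles: the lower bound on the mass comes from [q1], the upper one from
   [q0]. *)
apply/andP; split.
  exact: (qform_inv_le sym sym0 u1 u0 k0 (nonneg _ pos) q1).
exact: (qform_inv_le sym0 sym u0 u1 k0 (nonneg _ pos0) q0).
Qed.

End BandComparison.

(** * Regularity of the first band function *)

Section FirstBand.
Variables (R : realType) (d nu : nat) (G : pgraph d nu).
Hypothesis nu_gt0 : (0 < nu)%N.
Hypothesis wfG : wf_pgraph G.
Hypothesis connG : lift_connected G.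
Hypothesis deg_gt0 : forall v, (0 < deg G v)%N.

Lemma sum_cvg0 (I : Type) (r : seq I) (f : I -> R -> R) :
  (forall i, f i h @[h --> (0 : R)^'] --> (0 : R))%classic ->
  (\sum_(i <- r) f i h @[h --> (0 : R)^'] --> (0 : R))%classic.
Proof.
move=> f0; elim: r => [|i r IH].
  by apply: (@cvg_neq0_eq _ _ (fun=> 0)) => [h _|]; [rewrite big_nil|exact: cvg_cst].
have L : (f i h + \sum_(i <- r) f i h @[h --> (0 : R)^'] --> 0 + 0)%classic by exact: cvgD.
by rewrite addr0 in L; apply: cvg_neq0_eq L => h _; rewrite big_cons.
Qed.

Lemma osc_cvg (th x : 'rV[R]_d) :
  (osc G th (h *: x + th) @[h --> (0 : R)^'] --> (0 : R))%classic.
Proof.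
have c0 : ((fun=> (0 : R)) h @[h --> (0 : R)^'] --> (0 : R))%classic by exact: cvg_cst.
have to0 (f : R -> R) (b : R) : (f h @[h --> (0 : R)^'] --> b)%classic ->
    (`|f h - b| @[h --> (0 : R)^'] --> (0 : R))%classic.
  move=> fb; have L : (`|f h - b| @[h --> (0 : R)^'] --> `|b - b|)%classic.
    by apply: cvg_norm; apply: cvgB => //; exact: cvg_cst.
  by move: L; rewrite subrr normr0.
apply: sum_cvg0 => e.
have Lc := to0 _ _ (@texp_cvg R d (TCos R (tau G e)) _ _ th x c0).
have Ls := to0 _ _ (@texp_cvg R d (TSin R (tau G e)) _ _ th x c0).
rewrite -[X in (_ --> X)%classic](mulr0 (amp R e)); apply: cvgM; first exact: cvg_cst.
by rewrite -[X in (_ --> X)%classic](addr0 0); exact: cvgD.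
Qed.

(** The perturbation bound is symmetric in its two points, so the value is squeezed within [osc] of
    the limit. *)
Lemma lambda1_cvg (Q : 'I_nu -> R) (th x : 'rV[R]_d) :
  (lambda1 (fiberH G Q) (h *: x + th) @[h --> (0 : R)^'] --> lambda1 (fiberH G Q) th)%classic.
Proof.
have up th1 th2 : lambda1 (fiberH G Q) th2 <= lambda1 (fiberH G Q) th1 + osc G th1 th2.
  exact: lmin_osc.
apply: (@squeeze_cvgr _ _ _ _ (fun h => lambda1 (fiberH G Q) th - osc G th (h *: x + th))
                (fun h => lambda1 (fiberH G Q) th + osc G th (h *: x + th))).
- near=> h; rewrite up andbT lerBlDr osc_sym; exact: up.
- rewrite -[X in (_ --> X)%classic]subr0; apply: cvgB; [exact: cvg_cst|exact: osc_cvg].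
- rewrite -[X in (_ --> X)%classic]addr0; apply: cvgD; [exact: cvg_cst|exact: osc_cvg].
Unshelve. all: by end_near. Qed.

Lemma lambda1_ub (Q : 'I_nu -> R) : has_ubound (range (lambda1 (fiberH G Q))).
Proof.
exists (lambda1 (fiberH G Q) 0 + \sum_(e : arc G) amp R e * 4) => _ [th _ <-].
apply: le_trans (lmin_osc nu_gt0 wfG deg_gt0 Q 0 th) _.
by apply: lerD => //; exact: osc_le.
Qed.

Lemma lambda1_simple (Q : 'I_nu -> R) : exists (dr : 'I_nu -> R) i0,
  [/\ char_poly (fiberH G Q 0) = \prod_i ('X - ((dr i)%:C)%:P),
      lambda1 (fiberH G Q) 0 = dr i0 & forall i, i != i0 -> dr i != dr i0].
Proof.
have [psi [psi_gt0 psiE]] := perron nu_gt0 wfG connG deg_gt0 Q.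
apply: (lmin_simple nu_gt0 (fiberH_herm wfG Q 0)).
exact: ground_simple psi_gt0 psiE.
Qed.

Lemma lambda1_mup (Q : 'I_nu -> R) :
  mup ((lambda1 (fiberH G Q) 0)%:C) (char_poly (fiberH G Q 0)) = 1%N.
Proof.
have [dr [i0 [-> -> simp]]] := lambda1_simple Q.
rewrite (bigD1 i0) //= mupMl; first by rewrite -['X - _]expr1 mup_XsubCX eqxx.
rewrite /root horner_prod; apply/prodf_neq0 => i ii0.
by rewrite hornerXsubC subr_eq0 (inj_eq (@complexI R)) eq_sym simp.
Qed.

(** Applies the simple root analysis to the real part [F] of the characteristic polynomial;
    simplicity at 0 comes from [lambda1_simple]. *)
Lemma lambda1_hessian (Q : 'I_nu -> R) : let l := lambda1 (fiberH G Q) in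
  (forall th, l 0 <= l th) ->
  (hessian0 l)^T = hessian0 l /\
  forall x, second_deriv0 (fun t => l (t *: x) - l 0) (qform (hessian0 l) x).
Proof.
move=> l lmin0.
have [F [F' FE]] := trigC_char_poly G Q.
have F0 th : teval F (l th) th = 0.
  have : (char_poly (fiberH G Q th)).[(l th)%:C] = 0.
    apply/rootP; rewrite -eigenvalue_root_char; apply/eigenvalueP.
    by have [u u0 uE] := lmin_eigenvector nu_gt0 (fiberH_herm wfG Q th); exists u.
  by rewrite FE => -[].
have Fmu : teval (dmu F) (l 0) 0 != 0.
  have [dr [i0 [cE lE simp]]] := lambda1_simple Q.
  rewrite /l lE; apply: simple_root_dmu simp => mu.
  (* At [th = 0] all roots are real, so for real [mu] the polynomial equals its real part. *)
  have := FE mu 0; rewrite cE horner_prod.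
  under eq_bigr do rewrite hornerXsubC -rmorphB.
  by rewrite -rmorph_prod => -[].
have lc := @lambda1_cvg Q.
split; first exact: (root_hessian_sym F0 lc Fmu lmin0).
exact: (root_second_deriv0 F0 lc Fmu lmin0).
Qed.

End FirstBand.

Theorem theorem2p1 (R : realType) (d nu : nat) (G : pgraph d nu) (Q : 'I_nu -> R) :
  (2 <= d)%N -> (0 < nu)%N ->
  wf_pgraph G -> lift_connected G -> base_tree_exists G ->
  let H := fiberH G Q in
  let L := fiberH G (fun=> 0) in
  let l1 := lambda1 H in
  let l10 := lambda1 L in
  mup ((l1 0)%:C)%C (char_poly (H 0)) = 1%N /\
  exists psi : 'I_nu -> R,
    let c0 := psi_plus G psi / psi_minus G psi in
    [/\ forall v, 0 < psi v,
        H 0 *m colC psi = ((l1 0)%:C)%C *: colC psi,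
        band_minus l1 < band_plus l1
        /\ c0 ^- 2 * band_len l10 <= band_len l1 <= c0 ^+ 2 * band_len l10 &
        [/\ hessian0 l1 \in unitmx, hessian0 l10 \in unitmx &
            forall x : 'rV[R]_d,
              c0 ^- 2 * qform (eff_mass l10) x <= qform (eff_mass l1) x
                <= c0 ^+ 2 * qform (eff_mass l10) x]].
Proof.
move=> d2 nu0 wfG conn _ H L l1 l10.
have deg0 := lift_connected_deg_gt0 (ltnW d2) conn.
split; first exact: lambda1_mup.
have [psi [psi_gt0 psiE]] := perron nu0 wfG conn deg0 Q.
exists psi => c0.
(* [phi] is [psi] relative to the Laplacian's ground state; its extreme values are [psi_minus] and
   [psi_plus]. *)
pose phi v := psi v / sqrt_deg R G v.
have p0 v : 0 < sqrt_deg R G v by exact: sqrt_deg_gt0.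
have phi_gt0 v : 0 < phi v by rewrite divr_gt0.
have [vm _ vmin] := @arg_minP _ _ _ (Ordinal nu0) xpredT phi isT.
have [vM _ vmax] := @arg_maxP _ _ _ (Ordinal nu0) xpredT phi isT.
have am v : psi_minus G psi <= phi v.
  by apply: ge_inf; [exists (phi vm) => _ [w _ <-]; exact: vmin|exists v].
have bM v : phi v <= psi_plus G psi.
  by apply: ub_le_sup; [exists (phi vM) => _ [w _ <-]; exact: vmax|exists v].
(* The infimum runs over finitely many positive values, so it stays positive. *)
have a0 : 0 < psi_minus G psi.
  apply: (@lt_le_trans _ _ (phi vm)) => //; apply: lb_le_inf => [|_ [w _ <-]]; last exact: vmin.
  by exists (phi vm); exists vm.
have b0 : 0 < psi_plus G psi by exact: lt_le_trans (phi_gt0 vm) (bM vm).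
have l10E : l10 0 = 0.
  exact: (ground_lmin0 nu0 wfG deg0 p0 (sqrt_deg_eig R deg0)).
have l10_ge0 th : 0 <= l10 th.
  exact: (ground_le nu0 wfG deg0 p0 (sqrt_deg_eig R deg0) th).
have l1_ge th : l1 0 <= l1 th.
  exact: (ground_le nu0 wfG deg0 psi_gt0 psiE th).
have k0 : 0 < c0 ^+ 2 by rewrite exprn_gt0 // divr_gt0.
have c1 th : l1 th - l1 0 <= c0 ^+ 2 * l10 th.
  rewrite -[l10 th]subr0.
  apply: (ground_compare nu0 wfG deg0 th psi_gt0 psiE p0 (sqrt_deg_eig R deg0) a0) => v.
  by rewrite -ler_pdivlMr // am -ler_pdivrMr // bM.
have c2 th : l10 th <= c0 ^+ 2 * (l1 th - l1 0).
  rewrite -[l10 th]subr0.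
  (* With the roles exchanged, [sqrt_deg] lies between [psi] over [psi_plus] and [psi] over
     [psi_minus], so the ratio of the bounds is [c0] again. *)
  have -> : c0 = (psi_minus G psi)^-1 / (psi_plus G psi)^-1 by rewrite invrK mulrC.
  apply: (ground_compare nu0 wfG deg0 th p0 (sqrt_deg_eig R deg0) psi_gt0 psiE) => [|v].
    by rewrite invr_gt0.
  rewrite mulrC ler_pdivrMr // mulrC -ler_pdivrMr // bM /=.
  by rewrite mulrC ler_pdivlMr // mulrC -ler_pdivlMr // am.
have lower := laplace_lower R nu0 wfG conn deg0.
have [sym sec] := lambda1_hessian nu0 wfG conn deg0 l1_ge.
have l10_ge th : l10 0 <= l10 th by rewrite l10E.
have [sym0 sec0] := lambda1_hessian nu0 wfG conn deg0 l10_ge.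
split => //.
- rewrite fiberH_colC; apply/matrixP => v z; rewrite !mxE psiE rmorphM //.
- apply: (band_compare (j := Ordinal (ltnW d2))) => //.
  exact: lambda1_ub.
- exact: (effective_mass_compare k0 l10E c1 c2 lower sym sym0 sec sec0).
Qed.
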